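(* Let $\Delta t>0$ and let $(u_k,\rho_k,s_k),(u_{k+1},\rho_{k+1},s_{k+1})\in U_h^{\rm grad}\times V_h\times V_h$ be two successive states satisfying the fully discrete scheme $$\langle D_{\Delta t}(\rho u),v\rangle+a\big((\rho u)_{k+1/2},u_{k+1/2},v\big)-b_h\big(D_2\epsilon,s_{k+1/2},v\big)+b_h\Big(\tfrac12\pi_h(u_k\cdot u_{k+1})-D_1\epsilon-\pi_h\phi,\rho_{k+1/2},v\Big)=-c(1,u_{k+1/2},v),\ \ \forall v\in U_h^{\rm grad},$$ $$\langle D_{\Delta t}\rho,\theta\rangle+b_h(\theta,\rho_{k+1/2},u_{k+1/2})=0,\quad\forall\theta\in V_h,$$ $$\langle D_{\Delta t}s,D_2\epsilon\,w\rangle+b_h\big(D_2\epsilon\,w,s_{k+1/2},u_{k+1/2}\big)-d_h\big(1,D_2\epsilon,D_2\epsilon\,w\big)=c(w,u_{k+1/2},u_{k+1/2})-d_h(w,D_2\epsilon,D_2\epsilon)-e_h(w,D_2\epsilon),\ \ \forall w\in V_h,$$ where all notation, including the three possible choices of the pair $(d_h,e_h)$ (homogeneous Neumann, Dirichlet, nonhomogeneous Neumann), is given in the context. Then the energy balance and conservation of mass $$\frac{\mathcal E_{k+1}-\mathcal E_k}{\Delta t}=-e_h(1,D_2\epsilon),\qquad\int_\Omega\rho_{k+1}\,dx=\int_\Omega\rho_k\,dx$$ hold, where $\mathcal E_k=\int_\Omega\big[\frac12\rho_k|u_k|^2+\epsilon(\rho_k,s_k)+\rho_k\phi\big]dx$,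 as well as the second law $$\langle D_{\Delta t}s,D_2\epsilon\,w\rangle+b_h\big(D_2\epsilon\,w,s_{k+1/2},u_{k+1/2}\big)-d_h\big(1,D_2\epsilon,D_2\epsilon\,w\big)\ge0$$ for all $w\in DG_0(\mathcal T_h)$ with $w\ge0$, where in the Dirichlet and nonhomogeneous Neumann cases $w$ is in addition required to have compact support in the (open) domain $\Omega$.
   Context: Mesh and spaces. $\Omega\subset\mathbb R^d$, $d\in\{2,3\}$, is a bounded domain that is exactly triangulated by a conforming simplicial triangulation $\mathcal T_h$; $\mathcal E_h^0$ and $\mathcal E_h^\partial$ are the sets of interior and boundary codimension-1 faces, and $h_e$ is the diameter of the face $e$. For integers $q\ge0$, $r\ge1$: $DG_q(\mathcal T_h)=\{f\in L^2(\Omega):f|_K\in P_q(K)\ \forall K\}$ ($P_q$ = polynomials of degree $\le q$), $V_h=DG_q(\mathcal T_h)$, $U_h^{\rm grad}=\{u\in H_0^1(\Omega)^d:u|_K\in P_r(K)^d\ \forall K\}$. $\langle\cdot,\cdot\rangle$ is the $L^2(\Omega)$ inner product and $\pi_h:L^2(\Omega)\to V_h$ the $L^2$-orthogonal projector. On $e=K_1\cap K_2\in\mathcal E_h^0$: $\llbracket f\rrbracket=f_1n_1+f_2n_2$, $\{f\}=\frac12(f_1+f_2)$, with $f_i=f|_{K_i}$ and $n_i$ the unit normal to $e$ pointing outward from $K_i$ ($\{\cdot\}$ is componentwise for vector fields); $n$ is the outward unit normal on $\partial\Omega$. $\nabla_uf=u\cdot\nabla f$, $[u,v]=u\cdot\nabla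 v-v\cdot\nabla u$. Forms. $$a(w,u,v)=-\int_\Omega w\cdot[u,v]\,dx,\qquad b_h(f,\rho,u)=-\sum_{K\in\mathcal T_h}\int_K(\nabla_uf)\rho\,dx+\sum_{e\in\mathcal E_h^0}\int_eu\cdot\llbracket f\rrbracket\{\rho\}\,da,$$ $$c(w,u,v)=\int_\Omega w\,\sigma(u):\nabla v\,dx,\quad\sigma(u)=2\mu\,\mathrm{Def}\,u+\lambda(\mathrm{div}\,u)\delta,\quad\mathrm{Def}\,u=\tfrac12(\nabla u+\nabla u^{\mathsf T}),$$ $\delta$ the identity tensor, with constants $\mu\ge0$, $\lambda+\frac2d\mu\ge0$. With constant heat conductivity $\kappa\ge0$ and penalty parameter $\eta>0$, for $w,f,g$ piecewise polynomial on $\mathcal T_h$ set $$d_h^N(w,f,g)=-\sum_{K}\int_K\frac wf\kappa\nabla f\cdot\nabla g\,dx+\sum_{e\in\mathcal E_h^0}\int_e\frac1{\{f\}}\{w\kappa\nabla f\}\cdot\llbracket g\rrbracket\,da-\sum_{e\in\mathcal E_h^0}\int_e\frac1{\{f\}}\{w\kappa\nabla g\}\cdot\llbracket f\rrbracket\,da-\sum_{e\in\mathcal E_h^0}\frac\eta{h_e}\int_e\frac{\{w\}}{\{f\}}\llbracket f\rrbracket\cdot\llbracket g\rrbracket\,da .$$ The pair $(d_h,e_h)$ is one of the following. (i) Homogeneous Neumann: $d_h=d_h^N$, $e_h=0$. (ii) Dirichlet, with prescribed boundary temperature $T_0:\partial\Omega\to\mathbb R$: $$d_h(w,f,g)=d_h^N(w,f,g)-\sum_{e\in\mathcal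 E_h^\partial}\int_e\frac wf\kappa\nabla g\cdot n\,(f-T_0)\,da+\sum_{e\in\mathcal E_h^\partial}\int_e\frac wf\kappa\nabla f\cdot n\,g\,da,$$ $$e_h(w,f)=-\int_{\partial\Omega}\frac wf\kappa\nabla f\cdot n\,T_0\,da+\sum_{e\in\mathcal E_h^\partial}\frac\eta{h_e}\int_ew(f-T_0)\,da .$$ (iii) Nonhomogeneous Neumann, with prescribed boundary heat flux $q_0$ on $\partial\Omega$ (possibly depending on the boundary temperature $f$): $$d_h(w,f,g)=d_h^N(w,f,g)+\sum_{e\in\mathcal E_h^\partial}\int_e\frac wf\kappa\nabla f\cdot n\,g\,da,\qquad e_h(w,f)=\int_{\partial\Omega}w\,q_0\,da .$$ Thermodynamics and time discretization. $\phi:\Omega\to\mathbb R$ is a given (bounded) gravitational potential and $\epsilon=\epsilon(\rho,s)$ a given $C^1$ internal energy density, defined on a product of open intervals containing the values of $\rho_k,\rho_{k+1}$ and of $s_k,s_{k+1}$ respectively on every closed element. Set $$\delta_1(\rho,\rho',s)=\frac{\epsilon(\rho',s)-\epsilon(\rho,s)}{\rho'-\rho},\qquad\delta_2(s,s',\rho)=\frac{\epsilon(\rho,s')-\epsilon(\rho,s)}{s'-s}$$ (interpreted as the partial derivative $\partial\epsilon/\partial\rho$, respectively $\partial\epsilon/\partial s$, when the denominator vanishes), and $$D_1\epsilon=\pi_h\Big(\tfrac12\big[\delta_1(\rho_k,\rho_{k+1},s_k)+\delta_1(\rho_k,\rho_{k+1},s_{k+1})\big]\Big),\quad D_2\epsilon=\pi_h\Big(\tfrac12\big[\delta_2(s_k,s_{k+1},\rho_k)+\delta_2(s_k,s_{k+1},\rho_{k+1})\big]\Big).$$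 $D_2\epsilon$ plays the role of the discrete temperature and is assumed positive on every closed element. Further, $D_{\Delta t}x=\frac{x_{k+1}-x_k}{\Delta t}$, $D_{\Delta t}(\rho u)=\frac{\rho_{k+1}u_{k+1}-\rho_ku_k}{\Delta t}$, $x_{k+1/2}=\frac{x_k+x_{k+1}}2$, $(\rho u)_{k+1/2}=\frac{\rho_ku_k+\rho_{k+1}u_{k+1}}2$. *)

(* Defs.v *)
From HB Require Import structures.
From mathcomp Require Import all_boot all_order all_algebra.
From mathcomp Require Import all_classical all_reals all_analysis.
Set Implicit Arguments. Unset Strict Implicit. Unset Printing Implicit Defensive.
Import Order.TTheory GRing.Theory Num.Theory.
Import numFieldNormedType.Exports.
Local Open Scope classical_set_scope.
Local Open Scope ring_scope.

(** * Lebesgue measure on R^n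

    Row vectors carry the product sigma-algebra (which is the Borel one), and
    n-dimensional Lebesgue measure is the n-fold product of the
    one-dimensional one, transported along R * R^n ~ R^(n+1). *)

Section measurable_row.
Variables (R : realType) (n : nat).
Let coord (i : 'I_n) (x : 'rV[R]_n) : measurableTypeR R := x ord0 i.
Let mes := g_sigma_preimage coord.
Let mes0 : mes set0. Proof. exact: sigma_algebra0. Qed.
Let mesC A : mes A -> mes (~` A). Proof. exact: sigma_algebraC. Qed.
Let mesU (F : (set 'rV[R]_n)^nat) :
  (forall i, mes (F i)) -> mes (\bigcup_i F i).
Proof. exact: sigma_algebra_bigcup. Qed.
HB.instance Definition _ :=
  @isMeasurable.Build default_measure_display 'rV[R]_n mes mes0 mesC mesU.

Lemma measurable_coord (i : 'I_n) :
  measurable_fun setT (fun x : 'rV[R]_n => x ord0 i : measurableTypeR R).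
Proof.
move=> _ Y mY; rewrite setTI; apply: sub_sigma_algebra => /=.
rewrite -bigcup_seq/=; exists i => /=; first by rewrite mem_index_enum.
by exists Y => //; rewrite setTI.
Qed.

Lemma measurable_rowP d (T : measurableType d) (f : T -> 'rV[R]_n) :
  (forall i, measurable_fun setT (fun t => f t ord0 i : measurableTypeR R)) ->
  measurable_fun setT f.
Proof.
move=> mf.
have sub : g_sigma_preimage (fun i => coord i \o f) `<=` measurable.
  apply: smallest_sub; first exact: sigma_algebra_measurable.
  move=> A; rewrite -bigcup_seq => -[i _ [B mB <-]].
  exact: mf.
rewrite g_sigma_preimage_comp in sub.
by move=> _ A mA; apply: sub; exists A.
Qed.
End measurable_row.

Section lebesgue_row.
Variable R : realType.
Notation mR := (measurableTypeR R).

Definition row_cons n (z : mR * 'rV[R]_n) : 'rV[R]_n.+1 :=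
  row_mx z.1%:M z.2 : 'rV[R]_(1 + n).

Lemma measurable_row_cons n : measurable_fun setT (@row_cons n).
Proof.
apply: measurable_rowP => i.
case: (split_ordP (i : 'I_(1 + n))) => j ->.
  apply: (eq_measurable_fun fst); last exact: measurable_fst.
  move=> z _; rewrite /row_cons; apply/esym.
  by have /= -> := @row_mxEl R 1 1 n z.1%:M z.2 ord0 j; rewrite mxE !ord1 eqxx mulr1n.
apply: (eq_measurable_fun (fun z : mR * 'rV[R]_n => z.2 ord0 j : mR)).
  move=> z _; rewrite /row_cons; apply/esym.
  by have /= -> := @row_mxEr R 1 1 n (z.1 : R)%:M z.2 ord0 j.
apply: (measurableT_comp (measurable_coord j)).
exact: measurable_snd.
Qed.

Section row_cons_measure.
Variables (n : nat) (m : {sigma_finite_measure set 'rV[R]_n -> \bar R}).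

Definition measure_row_cons : set 'rV[R]_n.+1 -> \bar R :=
  pushforward (lebesgue_measure \x m)%E (@row_cons n).

HB.instance Definition _ := Measure.copy measure_row_cons
  (measure_function_pushforward__canonical__measure_function_Measure
     (lebesgue_measure \x m)%E (@measurable_row_cons n)).

Let sigma_finite_row_cons : sigma_finite setT measure_row_cons.
Proof.
have /sigma_finiteP[F [FT ndF Foo]] := sigma_finiteT (@lebesgue_measure R).
have /sigma_finiteP[G [GT ndG Goo]] := sigma_finiteT m.
pose split (x : 'rV[R]_(1 + n)) : mR * 'rV[R]_n :=
  (lsubmx x ord0 ord0, rsubmx x).
have splitK z : split (row_cons z) = z.
  by case: z => a y; rewrite /split /row_cons row_mxKl row_mxKr mxE eqxx mulr1n.
have msplit : measurable_fun setT (split : 'rV[R]_n.+1 -> _).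
  apply/measurable_fun_pairP; split.
    apply: (eq_measurable_fun
      (fun x : 'rV[R]_n.+1 => x ord0 (@lshift 1 n ord0) : mR)).
      by move=> x _ /=; rewrite mxE.
    exact: measurable_coord.
  apply: measurable_rowP => i.
  apply: (eq_measurable_fun
    (fun x : 'rV[R]_n.+1 => x ord0 (@rshift 1 n i) : mR)).
    by move=> x _ /=; rewrite mxE.
  exact: measurable_coord.
exists (fun k => split @^-1` (F k `*` G k)).
  rewrite -preimage_bigcup; apply/seteqP; split => // x _ /=.
  have [j _ Fj] : (\bigcup_i F i) (split x).1 by rewrite -FT.
  have [k _ Gk] : (\bigcup_i G i) (split x).2 by rewrite -GT.
  exists (maxn j k) => //; split.
  - by move: Fj; exact/subsetPset/ndF/leq_maxl.
  - by move: Gk; exact/subsetPset/ndG/leq_maxr.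
move=> k; have [mF Fk] := Foo k; have [mG Gk] := Goo k; split.
  by rewrite -[X in measurable X]setTI; apply: msplit => //; exact: measurableX.
rewrite /measure_row_cons /pushforward -comp_preimage.
rewrite (_ : _ \o _ = id) ?preimage_id; last exact/funext.
by rewrite product_measure1E// lte_mul_pinfty// ge0_fin_numE.
Qed.

HB.instance Definition _ := Measure_isSigmaFinite.Build _ _ _ measure_row_cons
  sigma_finite_row_cons.
End row_cons_measure.

Fixpoint lebesgue_row n : {sigma_finite_measure set 'rV[R]_n -> \bar R} :=
  match n return {sigma_finite_measure set 'rV[R]_n -> \bar R} with
  | 0 => dirac (0 : 'rV[R]_0)
  | n'.+1 => measure_row_cons (lebesgue_row n')
  end.
End lebesgue_row.

(** * Euclidean structure and polynomials

    The library norm on ['rV[R]_d] is the sup norm; lengths below are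
    Euclidean. *)

Section Euclidean.
Variables (R : realType) (d : nat).
Implicit Types (x y : 'rV[R]_d).

Definition dotv x y : R := (x *m y^T) 0 0.

Definition normv x : R := Num.sqrt (dotv x x).

(* Linear combinations of the monomials of total degree at most [q]. *)
Definition polynomial_le (q : nat) (f : 'rV[R]_d -> R) : Prop :=
  exists c : {ffun 'I_d -> 'I_q.+1} -> R, forall x,
    f x = \sum_(m : {ffun 'I_d -> 'I_q.+1} | (\sum_i (m i : nat) <= q)%N)
            c m * \prod_i x 0 i ^+ m i.

Definition partial (i : 'I_d) (f : 'rV[R]_d -> R) : 'rV[R]_d -> R :=
  fun x => 'D_(delta_mx 0 i) f x.

Definition grad (f : 'rV[R]_d -> R) (x : 'rV[R]_d) : 'rV[R]_d :=
  \row_i partial i f x.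

(* ['J u x] has (i, j) entry d(u_j)/dx_i, so that [u x *m 'J v x] is the
   vector u . nabla v. *)
Definition lie (u v : 'rV[R]_d -> 'rV[R]_d) (x : 'rV[R]_d) : 'rV[R]_d :=
  u x *m 'J v x - v x *m 'J u x.

Definition ddot (A B : 'M[R]_d) : R := \sum_i \sum_j A i j * B i j.

Definition Def (u : 'rV[R]_d -> 'rV[R]_d) (x : 'rV[R]_d) : 'M[R]_d :=
  2^-1 *: ('J u x + ('J u x)^T).

Definition stress (mu lam : R) (u : 'rV[R]_d -> 'rV[R]_d) (x : 'rV[R]_d) :
  'M[R]_d := (2 * mu) *: Def u x + (lam * \tr ('J u x))%:M.

Definition bounded_domain (Om : set 'rV[R]_d) : Prop :=
  [/\ open Om, connected Om, Om !=set0 & bounded_set Om].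

Definition supp (f : 'rV[R]_d -> R) : set 'rV[R]_d :=
  closure [set x | f x != 0].

Definition compactly_supported (Om : set 'rV[R]_d) (f : 'rV[R]_d -> R) : Prop :=
  compact (supp f) /\ supp f `<=` Om.

(* All iterated partial derivatives exist and are Frechet differentiable. *)
Definition smooth (f : 'rV[R]_d -> R) : Prop :=
  forall (s : seq 'I_d) (x : 'rV[R]_d),
    differentiable (foldr partial f s) x.

(* [f] is, in the H^1(Om) norm, the limit of test functions [phi n]; the limits
   [g i] of the partial derivatives are then the weak derivatives of [f]. *)
Definition H10 (Om : set 'rV[R]_d) (f : 'rV[R]_d -> R) : Prop :=
  exists (phi : nat -> 'rV[R]_d -> R) (g : 'I_d -> 'rV[R]_d -> R),
    [/\ measurable_fun Om f /\ (forall i, measurable_fun Om (g i)),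
        forall n, smooth (phi n) /\ compactly_supported Om (phi n),
        (\int[lebesgue_row R d]_(x in Om) (((phi n x - f x) ^+ 2)%:E))%E
          @[n --> \oo] --> 0%E &
        forall i,
        (\int[lebesgue_row R d]_(x in Om)
           (((partial i (phi n) x - g i x) ^+ 2)%:E))%E
          @[n --> \oo] --> 0%E].

End Euclidean.

(** * Triangulations *)

Section Simplices.
Variables (R : realType) (d n : nat) (p : 'I_n -> 'rV[R]_d).

Definition hull (S : {set 'I_n}) : set 'rV[R]_d :=
  [set x | exists t : 'I_n -> R,
    [/\ forall i, 0 <= t i, \sum_(i in S) t i = 1 &
        x = \sum_(i in S) t i *: p i]].

Definition affinely_independent (S : {set 'I_n}) : Prop :=
  forall t : 'I_n -> R, \sum_(i in S) t i = 0 ->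
    \sum_(i in S) t i *: p i = 0 -> forall i, i \in S -> t i = 0.

End Simplices.

(* Simplices and their faces are represented by their sets of vertex
   indices. *)
Record triangulation (R : realType) (d : nat) := Triangulation {
  nvert : nat;
  vtx : 'I_nvert -> 'rV[R]_d;
  elts : {set {set 'I_nvert}};
  elts_card : forall K, K \in elts -> #|K| = d.+1;
  elts_nondegenerate : forall K, K \in elts -> affinely_independent vtx K;
  elts_conforming : forall K K', K \in elts -> K' \in elts ->
    hull vtx K `&` hull vtx K' = hull vtx (K :&: K') }.

Section Mesh.
Variables (R : realType) (d : nat) (T : triangulation R d).

Notation simplex := {set 'I_(nvert T)}.
Implicit Types (K e : simplex).

(* Closed element, or closed face, of the mesh. *)
Definition cell (K : simplex) : set 'rV[R]_d := hull (@vtx R d T) K.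

(* The closure of [Om] is then the union of the elements. Taking the interior
   excludes domains with a slit along faces: a face common
   to two elements is never part of the boundary. *)
Definition exactly_triangulates (Om : set 'rV[R]_d) : Prop :=
  Om = (\bigcup_(K in [set` elts T]) cell K)°.

Definition elts_at e : {set simplex} := [set K in elts T | e \subset K].

Definition faces_int : {set simplex} :=
  [set e : simplex | (#|e| == d) && (#|elts_at e| == 2)].

Definition faces_bd : {set simplex} :=
  [set e : simplex | (#|e| == d) && (#|elts_at e| == 1)].

Definition is_outer_normal K e (n : 'rV[R]_d) : Prop :=
  [/\ normv n = 1,
      forall i j, i \in e -> j \in e -> dotv n (vtx i - vtx j) = 0 &
      forall i j, i \in e -> j \in K :\: e -> dotv n (vtx j - vtx i) < 0].

Definition normal K e : 'rV[R]_d := xget 0 [set n | is_outer_normal K e n].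

Definition diam e : R :=
  sup [set normv (x - y) | x in cell e & y in cell e].

Definition int_elt K (f : 'rV[R]_d -> R) : R :=
  \int[lebesgue_row R d]_(x in cell K) f x.

Definition ref_simplex (n : nat) : set 'rV[R]_n :=
  [set t | (forall i, 0 <= t 0 i) /\ \sum_i t 0 i <= 1].

Definition face_vtx e (k : nat) : 'rV[R]_d :=
  nth 0 [seq vtx i | i <- enum e] k.

Definition face_edges e : 'M[R]_(d.-1, d) :=
  \matrix_(i < d.-1) (face_vtx e i.+1 - face_vtx e 0).

(* Surface integral over a flat face, parametrized affinely by the reference
   simplex; the area factor is the square root of the Gram determinant of the
   edge vectors. *)
Definition int_face e (f : 'rV[R]_d -> R) : R :=
  Num.sqrt (\det (face_edges e *m (face_edges e)^T)) *
  \int[lebesgue_row R d.-1]_(t in @ref_simplex d.-1)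
    f (face_vtx e 0 + t *m face_edges e).

(** * Piecewise defined fields

    A piecewise field gives for each element K a function on the whole space;
    only its values on the closed simplex K matter. On a face it has one trace
    per adjacent element. For a piecewise polynomial f, [f K] is the
    polynomial f|_K. *)

Definition pw_field (V : Type) : Type := simplex -> 'rV[R]_d -> V.

(* The almost everywhere defined function on the domain represented by a
   piecewise field (set to 0 on the skeleton of the mesh). *)
Definition assemble (f : pw_field R) : 'rV[R]_d -> R :=
  fun x => \sum_(K in elts T) \1_((cell K)°) x * f K x.

Definition int_Om (Om : set 'rV[R]_d) (f : pw_field R) : R :=
  \int[lebesgue_row R d]_(x in Om) assemble f x.

Definition DG (q : nat) (f : pw_field R) : Prop :=
  forall K, K \in elts T -> polynomial_le q (f K).

Definition Ugrad (Om : set 'rV[R]_d) (r : nat) (u : pw_field 'rV[R]_d) : Prop :=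
  (forall K, K \in elts T -> forall i, polynomial_le r (fun x => u K x 0 i)) /\
  (forall i, H10 Om (assemble (fun K x => u K x 0 i))).

Definition inner (Om : set 'rV[R]_d) (f g : pw_field R) : R :=
  int_Om Om (fun K x => f K x * g K x).

Definition innerv (Om : set 'rV[R]_d) (u v : pw_field 'rV[R]_d) : R :=
  int_Om Om (fun K x => dotv (u K x) (v K x)).

(* Defining property of the L^2-orthogonal projection onto DG_q; it determines
   the polynomials [p K] for every element K. *)
Definition L2proj (Om : set 'rV[R]_d) (q : nat) (f : pw_field R) : pw_field R :=
  xget (fun _ _ => 0) [set p : pw_field R | DG q p /\
    forall v, DG q v -> inner Om (fun K x => f K x - p K x) v = 0].

Definition mean (V : lmodType R) (f : pw_field V) e (x : 'rV[R]_d) : V :=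
  2^-1 *: \sum_(K in elts_at e) f K x.

Definition jump (f : pw_field R) e (x : 'rV[R]_d) : 'rV[R]_d :=
  \sum_(K in elts_at e) f K x *: normal K e.

(* The sum over [elts_at e] has exactly one term on a boundary face; [F K n]
   is the integrand computed with the trace from K and the outward unit normal
   n. *)
Definition int_bd_face e (F : simplex -> 'rV[R]_d -> 'rV[R]_d -> R) : R :=
  \sum_(K in elts_at e) int_face e (fun x => F K (normal K e) x).

(** * Forms *)

Definition form_a (Om : set 'rV[R]_d) (w u v : pw_field 'rV[R]_d) : R :=
  - int_Om Om (fun K x => dotv (w K x) (lie (u K) (v K) x)).

(* For u in the velocity space both traces on an interior face agree, and
   [mean u] is their common value. *)
Definition form_b (f rho : pw_field R) (u : pw_field 'rV[R]_d) : R :=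
  - (\sum_(K in elts T)
      int_elt K (fun x => dotv (u K x) (grad (f K) x) * rho K x))
  + \sum_(e in faces_int)
      int_face e (fun x => dotv (mean u e x) (jump f e x) * mean rho e x).

Definition form_c (Om : set 'rV[R]_d) (mu lam : R) (w : pw_field R)
    (u v : pw_field 'rV[R]_d) : R :=
  int_Om Om (fun K x => w K x * ddot (stress mu lam (u K) x) ('J (v K) x)).

Section Heat.
Variables (kappa eta : R).

Definition heat_flux (w f : pw_field R) : pw_field 'rV[R]_d :=
  fun K x => (w K x * kappa) *: grad (f K) x.

Definition form_dN (w f g : pw_field R) : R :=
  - (\sum_(K in elts T) int_elt K (fun x =>
       w K x / f K x * kappa * dotv (grad (f K) x) (grad (g K) x)))
  + (\sum_(e in faces_int) int_face e (fun x =>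
       (mean f e x)^-1 * dotv (mean (heat_flux w f) e x) (jump g e x)))
  - (\sum_(e in faces_int) int_face e (fun x =>
       (mean f e x)^-1 * dotv (mean (heat_flux w g) e x) (jump f e x)))
  - (\sum_(e in faces_int) eta / diam e * int_face e (fun x =>
       mean w e x / mean f e x * dotv (jump f e x) (jump g e x))).

(* [NeumannFlux q0]: the flux at a boundary point x where the boundary
   temperature is t is [q0 x t]. *)
Inductive boundary_condition : Type :=
  | NeumannHomogeneous
  | Dirichlet of 'rV[R]_d -> R
  | NeumannFlux of 'rV[R]_d -> R -> R.

Definition form_d (bc : boundary_condition) (w f g : pw_field R) : R :=
  match bc with
  | NeumannHomogeneous => form_dN w f g
  | Dirichlet T0 =>
      form_dN w f g
      - (\sum_(e in faces_bd) int_bd_face e (fun K n x =>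
           w K x / f K x * kappa * dotv (grad (g K) x) n * (f K x - T0 x)))
      + (\sum_(e in faces_bd) int_bd_face e (fun K n x =>
           w K x / f K x * kappa * dotv (grad (f K) x) n * g K x))
  | NeumannFlux q0 =>
      form_dN w f g
      + (\sum_(e in faces_bd) int_bd_face e (fun K n x =>
           w K x / f K x * kappa * dotv (grad (f K) x) n * g K x))
  end.

Definition form_e (bc : boundary_condition) (w f : pw_field R) : R :=
  match bc with
  | NeumannHomogeneous => 0
  (* The boundary of the domain is the union of the boundary faces. *)
  | Dirichlet T0 =>
      - (\sum_(e in faces_bd) int_bd_face e (fun K n x =>
           w K x / f K x * kappa * dotv (grad (f K) x) n * T0 x))
      + (\sum_(e in faces_bd) eta / diam e *
           int_bd_face e (fun K n x => w K x * (f K x - T0 x)))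
  | NeumannFlux q0 =>
      \sum_(e in faces_bd) int_bd_face e (fun K n x => w K x * q0 x (f K x))
  end.

End Heat.

(** * Time discretization *)

Definition time_diff (V : lmodType R) (tau : R) (f0 f1 : pw_field V) :
  pw_field V := fun K x => tau^-1 *: (f1 K x - f0 K x).

Definition midpoint (V : lmodType R) (f0 f1 : pw_field V) : pw_field V :=
  fun K x => 2^-1 *: (f0 K x + f1 K x).

Definition mul_field (f g : pw_field R) : pw_field R :=
  fun K x => f K x * g K x.

Definition scale_field (rho : pw_field R) (u : pw_field 'rV[R]_d) :
  pw_field 'rV[R]_d := fun K x => rho K x *: u K x.

Definition one_field : pw_field R := fun _ _ => 1.

(** * Thermodynamics *)

Section Energy.
Variable eps : R -> R -> R.

Definition C1_on (I J : set R) : Prop :=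
  forall r s, I r -> J s ->
  [/\ derivable (eps ^~ s) r 1, derivable (eps r) s 1,
      {for (r, s), continuous (fun z : R * R => derive1 (eps ^~ z.2) z.1)} &
      {for (r, s), continuous (fun z : R * R => derive1 (eps z.1) z.2)}].

Definition delta1 (r r' s : R) : R :=
  if r' == r then derive1 (eps ^~ s) r else (eps r' s - eps r s) / (r' - r).

Definition delta2 (s s' r : R) : R :=
  if s' == s then derive1 (eps r) s else (eps r s' - eps r s) / (s' - s).

Definition D1eps (Om : set 'rV[R]_d) (q : nat) (r0 r1 s0 s1 : pw_field R) :
  pw_field R := L2proj Om q (fun K x =>
    2^-1 * (delta1 (r0 K x) (r1 K x) (s0 K x)
            + delta1 (r0 K x) (r1 K x) (s1 K x))).

Definition D2eps (Om : set 'rV[R]_d) (q : nat) (r0 r1 s0 s1 : pw_field R) :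
  pw_field R := L2proj Om q (fun K x =>
    2^-1 * (delta2 (s0 K x) (s1 K x) (r0 K x)
            + delta2 (s0 K x) (s1 K x) (r1 K x))).

Definition energy (Om : set 'rV[R]_d) (phi : 'rV[R]_d -> R)
    (u : pw_field 'rV[R]_d) (rho s : pw_field R) : R :=
  int_Om Om (fun K x =>
    2^-1 * rho K x * dotv (u K x) (u K x) + eps (rho K x) (s K x)
    + rho K x * phi x).

End Energy.

Definition values_in (f : pw_field R) (I : set R) : Prop :=
  forall K, K \in elts T -> forall x, cell K x -> I (f K x).

End Mesh.

Arguments NeumannHomogeneous {R d}.

(* Main.v *)
(* The scheme is built so that the chain rule holds exactly in discrete form:
   with D = (.)_(k+1) - (.)_k, the energy density satisfies pointwise
     D(rho |u|^2 / 2 + eps + rho phi)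
       = D(rho u) . u_(k+1/2)
         + D(rho) (- u_k . u_(k+1) / 2 + d1 + phi) + D(s) d2,
   where d1, d2 are the averaged divided differences of eps. Since D(rho) and
   D(s) are piecewise polynomial, u_k . u_(k+1), d1, phi and d2 may be replaced
   by their L^2 projections; testing the momentum, density and entropy equations
   with u_(k+1/2), with the projected bracket and with 1 then makes all terms but
   e_h cancel. Mass is conserved because the two normals of an interior face are
   opposite, so that the jump of 1 vanishes. In the second law the two
   consistency terms of d_h^N cancel on the diagonal, what is left is a sum of
   squares, and a nonnegative piecewise constant w with compact support in the
   domain vanishes on every element touching the boundary along a face, which
   kills the boundary terms. *)

Require Import Defs.
From HB Require Import structures.
From mathcomp Require Import all_boot all_order all_algebra.
From mathcomp Require Import all_classical all_reals all_analysis measurable_realfun.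
From mathcomp Require Import ring lra.
Set Implicit Arguments.
Unset Strict Implicit.
Unset Printing Implicit Defensive.
Import Order.TTheory GRing.Theory Num.Theory.
Import numFieldNormedType.Exports.
Local Open Scope classical_set_scope.
Local Open Scope ring_scope.

(** * Lebesgue measure on row vectors *)

(** The overview moves freely between integrals, projections and normals, whereas in the code each
    of these is a total function with a default value. The integral is linear only on integrable
    functions, so every integrand is shown to be bounded and measurable on the interiors of the
    elements, a class closed under sums and products. For the terms in [eps] this rests on
    compactness: on a closed element density and entropy stay in a compact box inside [I] x [J],
    where the partial derivatives are bounded and the mean value theorem bounds the difference
    quotients. The projection is picked by [xget], so its existence is proved, element by element,
    from normal equations. Normals are picked by [xget] as well; conformity of the mesh puts two
    elements with a common face on opposite sides of it. Testing with the midpoint velocity requires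
    midpoints to stay in [H10], which is a closure of test functions. The viscous term, on which the
    second law also depends, has a sign because the squared norm of [Def u] is at least the squared
    divergence divided by [d]. *)

Section measurability.
Variables (R : realType) (d : nat).
Local Notation rv := 'rV[R]_d.

Lemma measurable_rat_box (a b : 'I_d -> rat) :
  measurable [set x : rv | forall i, ratr (a i) < x ord0 i < ratr (b i)].
Proof.
rewrite (_ : [set _ | _] = \bigcap_(i in [set: 'I_d])
    (fun x : rv => x ord0 i : measurableTypeR R) @^-1`
      `]ratr (a i), ratr (b i)[%classic); last first.
  by apply/seteqP; split => x /= h i; [move=> _|]; have := h i;
    rewrite /= in_itv/=; [|apply].
apply: fin_bigcap_measurable => [|i _]; first exact: finite_finset.
rewrite -[X in measurable X]setTI.
by apply: measurable_coord => //; exact: measurable_itv.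
Qed.

(** The sigma-algebra is generated by the coordinates, so an open set has to be exhausted by
    countably many boxes, here those with rational endpoints. A box not contained in [A] is replaced
    by [set0], which lets the union run over all indices. *)
Lemma open_measurable_row (A : set rv) : open A -> measurable A.
Proof.
move=> oA.
pose B (p : {ffun 'I_d -> rat * rat}) : set rv :=
  [set x : rv | forall i, ratr (p i).1 < x ord0 i < ratr (p i).2].
rewrite (_ : A = \bigcup_p (if pselect (B p `<=` A) then B p else set0)).
  apply: countable_bigcupT_measurable => // p.
  by case: pselect => //= _; exact: measurable_rat_box.
apply/seteqP; split => x; last first.
  by move=> [p _]; case: pselect => // h /h.
move=> Ax; have /nbhs_ballP[e /= e0 eA] : nbhs x A by exact: open_nbhs_nbhs.
have ex i : exists ab : rat * rat, x ord0 i - e < ratr ab.1 < x ord0 i /\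
    x ord0 i < ratr ab.2 < x ord0 i + e.
  have /rat_in_itvoo[a ha] : x ord0 i - e < x ord0 i by rewrite ltrBlDr ltrDl.
  have /rat_in_itvoo[b hb] : x ord0 i < x ord0 i + e by rewrite ltrDl.
  by exists (a, b); move: ha hb; rewrite !in_itv.
have [p Hp] := choice ex.
exists [ffun i => p i] => //=.
case: pselect => [sub|[]].
  by move=> i; rewrite ffunE; have [/andP[_ ->] /andP[->]] := Hp i.
move=> y By; apply: eA; split => // i j; rewrite ord1.
have := By j; rewrite ffunE.
have [/andP[h1 _] /andP[_ h2]] := Hp j.
rewrite /ball/= => /andP[h3 h4]; rewrite ltr_norml; apply/andP; split; lra.
Qed.

Lemma continuous_measurable_row (D : set rv) (f : rv -> R) : open D ->
  {in D, continuous f} -> measurable_fun D f.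
Proof.
move=> oD cf; apply: (measurability _ (RGenOpens.measurableE R)).
move=> _ [_ [a [b ->] <-]]; apply: open_measurable_row.
rewrite openE => x [Dx fx]; apply: filterI; first exact: open_nbhs_nbhs.
apply: (cf x); first exact: mem_set.
by apply: open_nbhs_nbhs; split => //; exact: interval_open.
Qed.

End measurability.

Section lebesgue_row_bounded.
Variable R : realType.

Lemma measurable_abs_box (d : nat) (B : R) :
  measurable [set x : 'rV[R]_d | forall i, `|x ord0 i| <= B].
Proof.
rewrite (_ : [set _ | _] = \bigcap_(i in [set: 'I_d])
    (fun x : 'rV[R]_d => x ord0 i : measurableTypeR R) @^-1`
      `[- B, B]%classic); last first.
  by apply/seteqP; split => x /= h i; [move=> _|]; have := h i;
    rewrite /= in_itv/= -ler_norml; [|apply].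
apply: fin_bigcap_measurable => [|i _]; first exact: finite_finset.
by rewrite -[X in measurable X]setTI; apply: measurable_coord.
Qed.

(** Induction along [row_cons]: the preimage of a cube is the product of a segment and a cube of one
    dimension less. Every set that is bounded in the sup norm lies in such a cube. *)
Lemma lebesgue_row_box (d : nat) (B : R) : 0 <= B ->
  (lebesgue_row R d [set x | forall i, (`|x ord0 i| <= B)%R] < +oo)%E.
Proof.
move=> B0; elim: d => [|d ih] /=.
  by rewrite diracE; case: (_ \in _) => /=; rewrite ?ltry.
rewrite /measure_row_cons /pushforward.
rewrite (_ : _ @^-1` _ = `[- B, B]%classic `*`
    [set x : 'rV[R]_d | forall i, (`|x ord0 i| <= B)%R]); last first.
  have El (a : R) (y : 'rV[R]_d) :
      @row_cons R d (a, y) ord0 (@lshift 1 d ord0) = a.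
    rewrite /row_cons; have /= -> := @row_mxEl R 1 1 d a%:M y ord0 ord0.
    by rewrite mxE eqxx mulr1n.
  have Er (a : R) (y : 'rV[R]_d) j :
      @row_cons R d (a, y) ord0 (@rshift 1 d j) = y ord0 j.
    by rewrite /row_cons; have /= -> := @row_mxEr R 1 1 d a%:M y ord0 j.
  apply/seteqP; split => -[a y] /=.
    move=> h; split => [|i].
      by have hl := h (@lshift 1 d ord0); rewrite in_itv/= -ler_norml -(El a y).
    by rewrite -(Er a y); exact: h.
  rewrite in_itv/= -ler_norml => -[ha hy] i.
  by case: (@split_ordP 1 d i) => j ->; rewrite ?ord1;
    [have -> := El a y|have -> := Er a y j].
rewrite product_measure1E//; last exact: measurable_abs_box.
apply: lte_mul_pinfty => //.
by rewrite /= lebesgue_measure_itv/=; case: ifP => _; rewrite ?ltry.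
Qed.

End lebesgue_row_bounded.

(** * Polynomials and orthogonal projections *)

Section polynomials.
Variables (R : realType) (d : nat).
Local Notation rv := 'rV[R]_d.

(** The value 0 beyond total degree [q] turns the polynomials of degree at most [q] into the span of
    a family indexed by a whole finite type. The family may contain zero functions, so its Gram
    matrix may be singular. *)
Definition monomial (q : nat) (m : {ffun 'I_d -> 'I_q.+1}) (x : rv) : R :=
  if (\sum_i (m i : nat) <= q)%N then \prod_i x 0 i ^+ m i else 0.

Lemma polynomial_leE (q : nat) (f : rv -> R) :
  polynomial_le q f <->
  exists c : {ffun 'I_d -> 'I_q.+1} -> R, f = fun x => \sum_m c m * monomial m x.
Proof.
have E (c : {ffun 'I_d -> 'I_q.+1} -> R) (x : rv) :
    \sum_(m : {ffun 'I_d -> 'I_q.+1} | (\sum_i (m i : nat) <= q)%N) c m * \prod_i x 0 i ^+ m i = \sum_m c m * monomial m x :> R.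
  rewrite big_mkcond; apply: eq_bigr => m _.
  by rewrite /monomial; case: ifP; rewrite ?mulr0.
by split => -[c h]; exists c; [apply/funext|] => x; rewrite h E.
Qed.

Lemma polynomial_le_lin (q : nat) (a b : R) (f g : rv -> R) :
  polynomial_le q f -> polynomial_le q g ->
  polynomial_le q (fun x => a * f x + b * g x).
Proof.
move=> [c cf] [c' cg]; exists (fun m => a * c m + b * c' m) => x.
rewrite cf cg !mulr_sumr -big_split/=; apply: eq_bigr => m _; ring.
Qed.

Lemma polynomial_le_cst (q : nat) (a : R) : polynomial_le q (fun _ : rv => a).
Proof.
exists (fun m => if m == [ffun _ => ord0] then a else 0) => x.
rewrite (bigD1 [ffun _ => ord0])/=; last first.
  by rewrite big1// => i _; rewrite ffunE.
rewrite eqxx big1 ?big1 ?mulr1 ?addr0// => [m /andP[_ /negPf ->]|i _].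
  by rewrite mul0r.
by rewrite ffunE expr0.
Qed.

Lemma polynomial_le0 (f : rv -> R) : polynomial_le 0 f ->
  exists a, f = fun=> a.
Proof.
move=> [c cf]; exists (\sum_m c m); apply/funext => x; rewrite cf.
rewrite [LHS]big_mkcond; apply: eq_bigr => m _; rewrite big1 => [|i _].
  rewrite leqnn big1 ?mulr1// => i _.
  by rewrite ord1 expr0.
by rewrite ord1.
Qed.

Lemma continuous_polynomial_le (q : nat) (f : rv -> R) :
  polynomial_le q f -> continuous f.
Proof.
move=> [c cf]; rewrite (_ : f = fun x => \sum_(m : {ffun 'I_d -> 'I_q.+1} |
  (\sum_i (m i : nat) <= q)%N) c m * \prod_i x 0 i ^+ m i); last exact/funext.
apply: continuous_big => [|m _]; first exact: add_continuous.
move=> x; apply: continuousM; first exact: cst_continuous.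
apply: (@continuous_big R _ *%R 1 predT) => [|i _ {}x].
  exact: mul_continuous.
have h : {for x, continuous (fun y : rv => y 0 i)} by exact: coord_continuous.
exact: (continuous_comp h (@exprn_continuous _ _ _)).
Qed.

Lemma monomial_polynomial_le (q : nat) (m : {ffun 'I_d -> 'I_q.+1}) :
  polynomial_le q (monomial m).
Proof.
apply/polynomial_leE; exists (fun m' => (m' == m)%:R); apply/funext => x.
rewrite (bigD1 m)//= eqxx mul1r big1 ?addr0// => m' /negPf ->.
by rewrite mul0r.
Qed.

End polynomials.

Section bounded_measurable.
Variables (R : realType) (d : nat) (D : set 'rV[R]_d).
Local Notation rv := 'rV[R]_d.
Local Notation mu := (lebesgue_row R d).
Implicit Types f g h : rv -> R.

(** Unlike integrability, this property is stable under products, and on a set of finite measure it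
    implies integrability. *)
Definition bounded_measurable f : Prop :=
  measurable_fun D f /\ exists M : R, forall x, D x -> `|f x| <= M.

Lemma bounded_measurable_cst (a : R) : bounded_measurable (fun=> a).
Proof. by split; [exact: measurable_cst|exists `|a|]. Qed.

Lemma bounded_measurableD f g : bounded_measurable f -> bounded_measurable g ->
  bounded_measurable (fun x => f x + g x).
Proof.
move=> [mf [M hM]] [mg [N hN]]; split; first exact: measurable_funD.
exists (M + N) => x Dx; rewrite (le_trans (ler_normD _ _))// lerD//.
  exact: hM.
exact: hN.
Qed.

Lemma bounded_measurableM f g : bounded_measurable f -> bounded_measurable g ->
  bounded_measurable (fun x => f x * g x).
Proof.
move=> [mf [M hM]] [mg [N hN]]; split; first exact: measurable_funM.
exists (M * N) => x Dx; rewrite normrM ler_pM//; [exact: hM|exact: hN].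
Qed.

Lemma bounded_measurableB f g : bounded_measurable f -> bounded_measurable g ->
  bounded_measurable (fun x => f x - g x).
Proof.
move=> bf bg; rewrite (_ : (fun _ => _) = fun x => f x + -1 * g x); last first.
  by apply/funext => x; rewrite mulN1r.
by apply: bounded_measurableD => //; apply: bounded_measurableM => //;
  exact: bounded_measurable_cst.
Qed.

Lemma bounded_measurable_sum (I : finType) (F : I -> rv -> R) :
  (forall i, bounded_measurable (F i)) ->
  bounded_measurable (fun x => \sum_i F i x).
Proof.
move=> bF; rewrite (_ : (fun _ => _) = \sum_i F i); last first.
  by apply/funext => x; rewrite fct_sumE.
elim/big_ind : _ => // [|f g bf bg]; first exact: (bounded_measurable_cst 0).
exact: bounded_measurableD.
Qed.

Hypotheses (mD : measurable D) (finD : (mu D < +oo)%E).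

Lemma bounded_measurable_integrable f :
  bounded_measurable f -> mu.-integrable D (EFin \o f).
Proof.
move=> [mf [M hM]]; apply: measurable_bounded_integrable => //.
exists M; split; first exact: num_real.
by move=> N MN x Dx; apply: le_trans (hM _ Dx) _; exact: ltW.
Qed.

Lemma bounded_measurable_integral_lin a b f g :
  bounded_measurable f -> bounded_measurable g ->
  \int[mu]_(x in D) (a * f x + b * g x)
    = a * \int[mu]_(x in D) f x + b * \int[mu]_(x in D) g x.
Proof.
move=> bf bg; have ic c h : bounded_measurable h ->
    mu.-integrable D (EFin \o (fun x => c * h x)).
  move=> bh; apply: bounded_measurable_integrable.
  by apply: bounded_measurableM => //; exact: bounded_measurable_cst.
by rewrite RintegralD ?ic// !RintegralZl//; exact: bounded_measurable_integrable.
Qed.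

Lemma bounded_measurable_integral_sum (I : finType) (F : I -> rv -> R) :
  (forall i, bounded_measurable (F i)) ->
  \int[mu]_(x in D) (\sum_i F i x) = \sum_i \int[mu]_(x in D) F i x.
Proof.
move=> bF; rewrite (_ : (fun x => \sum_i F i x) = \sum_i F i); last first.
  by apply/funext => x; rewrite fct_sumE.
suff : bounded_measurable (\sum_i F i) /\
    \int[mu]_(x in D) (\sum_i F i) x = \sum_i \int[mu]_(x in D) F i x by case.
elim/big_ind2 : _ => // [|f a g b [bf <-] [bg <-]].
  split; first exact: (bounded_measurable_cst 0).
  by rewrite Rintegral_cst// mul0r.
split; first exact: bounded_measurableD.
have := bounded_measurable_integral_lin 1 1 bf bg.
by rewrite !mul1r => <-; apply: eq_Rintegral => x _; rewrite !mul1r.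
Qed.

(* The normal equations [c *m G = b] are solvable although the Gram matrix [G]
   may be singular: a vector in its kernel represents a function h with
   [\int h^2 = 0], and then [\int f h = 0] as [\int (f + t h)^2 >= 0] for all t. *)
Lemma orthogonal_projection_exists (I : finType) (e : I -> rv -> R) f :
  (forall i, bounded_measurable (e i)) -> bounded_measurable f ->
  exists c : I -> R, forall j,
    \int[mu]_(x in D) ((f x - \sum_i c i * e i x) * e j x) = 0.
Proof.
move=> be bf; pose E (i : 'I_#|I|) := e (enum_val i).
have bE i : bounded_measurable (E i) by exact: be.
have bZ a g : bounded_measurable g -> bounded_measurable (fun x => a * g x).
  by move=> bg; apply: bounded_measurableM => //; exact: bounded_measurable_cst.
have Lsum (y : 'I_#|I| -> R) g : bounded_measurable g ->
    \int[mu]_(x in D) ((\sum_i y i * E i x) * g x)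
    = \sum_i y i * \int[mu]_(x in D) (E i x * g x).
  move=> bg; under eq_Rintegral do rewrite mulr_suml.
  rewrite bounded_measurable_integral_sum => [|i]; last first.
    by apply: bounded_measurableM => //; exact: bZ.
  apply: eq_bigr => i _; rewrite -RintegralZl//; last first.
    by apply: bounded_measurable_integrable; exact: bounded_measurableM.
  by apply: eq_Rintegral => x _; rewrite mulrA.
pose G := \matrix_(i, j) \int[mu]_(x in D) (E i x * E j x).
pose b : 'rV_#|I| := \row_j \int[mu]_(x in D) (E j x * f x).
have bG : (b <= G)%MS.
  rewrite submxE; apply/eqP/rowP => k; rewrite !mxE.
  pose y i := cokermx G i k; pose h x := \sum_i y i * E i x.
  have bh : bounded_measurable h.
    by apply: bounded_measurable_sum => i; exact: bZ.
  have hh : \int[mu]_(x in D) (h x * h x) = 0.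
    rewrite /h Lsum// big1// => i _.
    under eq_Rintegral do rewrite mulrC.
    rewrite Lsum//.
    have /matrixP/(_ i k) := mulmx_coker G; rewrite !mxE => E0.
    rewrite (_ : \sum_j _ = 0) ?mulr0// -[RHS]E0.
    apply: eq_bigr => j _; rewrite /G mxE mulrC.
    by congr (_ * _); apply: eq_Rintegral => x _; rewrite mulrC.
  have -> : \sum_j b 0 j * cokermx G j k = \int[mu]_(x in D) (h x * f x).
    by rewrite /h Lsum//; apply: eq_bigr => j _; rewrite mxE mulrC.
  set C := \int[mu]_(x in D) _.
  pose A := \int[mu]_(x in D) (f x * f x).
  have pos t : 0 <= A + 2 * t * C.
    have -> : A + 2 * t * C =
        \int[mu]_(x in D) ((f x + t * h x) * (f x + t * h x)).
      pose g1 x := 1 * (f x * f x) + (2 * t) * (h x * f x).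
      have bg1 : bounded_measurable g1.
        by apply: bounded_measurableD; apply: bZ; exact: bounded_measurableM.
      transitivity (\int[mu]_(x in D) (1 * g1 x + (t * t) * (h x * h x))).
        rewrite bounded_measurable_integral_lin ?hh ?mulr0 ?addr0 ?mul1r//.
          by rewrite bounded_measurable_integral_lin ?mul1r//;
            exact: bounded_measurableM.
        exact: bounded_measurableM.
      by apply: eq_Rintegral => x _; rewrite /g1; ring.
    by apply: Rintegral_ge0 => x _; rewrite -expr2 sqr_ge0.
  apply/eqP; apply: contraT => C0.
  (* Since the coefficient of [t ^+ 2] vanishes, the integral is affine in [t]; at this [t] it would
     equal -1. *)
  have := pos (- (A + 1) / (2 * C)).
  suff -> : A + 2 * (- (A + 1) / (2 * C)) * C = -1 by lra.
  by field.
have /submxP[c cG] := bG.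
exists (fun i => c 0 (enum_rank i)) => j.
transitivity (\int[mu]_(x in D) (1 * (E (enum_rank j) x * f x)
   + -1 * ((\sum_i c 0 i * E i x) * E (enum_rank j) x))).
  apply: eq_Rintegral => x _; rewrite {1 3}/E enum_rankK.
  rewrite (reindex_onto (@enum_rank I) enum_val) => [|i _]; last exact: enum_valK.
  rewrite (eq_bigl predT) => [|i]; last by rewrite /= enum_rankK eqxx.
  under [in RHS]eq_bigr do rewrite /E enum_rankK.
  ring.
have bs : bounded_measurable (fun x => \sum_i c 0 i * E i x).
  by apply: bounded_measurable_sum => i; exact: bZ.
rewrite bounded_measurable_integral_lin//; try exact: bounded_measurableM.
rewrite Lsum//.
have /rowP/(_ (enum_rank j)) := cG; rewrite !mxE => ->.
rewrite mul1r mulN1r; apply/eqP; rewrite subr_eq0; apply/eqP.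
by apply: eq_bigr => i _; rewrite mxE.
Qed.

End bounded_measurable.

(** * Simplices and barycentric coordinates *)

Section inner_product.
Variables (R : realType) (d : nat).
Implicit Types (x y z : 'rV[R]_d).

Lemma dotvE x y : dotv x y = \sum_i x 0 i * y 0 i.
Proof. by rewrite /dotv mxE; apply: eq_bigr => i _; rewrite mxE. Qed.

Lemma dotv_linr a b x y z : dotv x (a *: y + b *: z) = a * dotv x y + b * dotv x z.
Proof.
rewrite !dotvE !mulr_sumr -big_split; apply: eq_bigr => i _ /=.
rewrite !mxE; ring.
Qed.

Lemma dotvC x y : dotv x y = dotv y x.
Proof. by rewrite !dotvE; apply: eq_bigr => i _; rewrite mulrC. Qed.

Lemma dotv_linl a b x y z : dotv (a *: y + b *: z) x = a * dotv y x + b * dotv z x.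
Proof. by rewrite dotvC dotv_linr !(dotvC x). Qed.

Lemma dotvNl x y : dotv (- x) y = - dotv x y.
Proof.
have := dotv_linl (-1) 0 y x x; rewrite !scaleN1r scale0r addr0 => ->; ring.
Qed.

Lemma dotv0 x : dotv x 0 = 0.
Proof. by rewrite dotvE big1// => i _; rewrite mxE mulr0. Qed.

Lemma dotv_ge0 x : 0 <= dotv x x.
Proof. by rewrite dotvE; apply: sumr_ge0 => i _; rewrite -expr2 sqr_ge0. Qed.

Lemma dotv_eq0 x : dotv x x = 0 -> x = 0.
Proof.
rewrite dotvE => /psumr_eq0P h; apply/rowP => i; rewrite mxE; apply/eqP.
by rewrite -sqrf_eq0 expr2 h// => j _; rewrite -expr2 sqr_ge0.
Qed.

Lemma dotv_affine (I : finType) (S : {set I}) (t : I -> R) (p : I -> 'rV[R]_d) z x :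
  \sum_(i in S) t i = 1 ->
  dotv z (\sum_(i in S) t i *: p i - x) = \sum_(i in S) t i * dotv z (p i - x).
Proof.
move=> t1; rewrite -[X in _ - X]scale1r -t1 scaler_suml -sumrB.
rewrite dotvE; under eq_bigr do rewrite summxE mulr_sumr.
rewrite exchange_big; apply: eq_bigr => i _; rewrite dotvE mulr_sumr.
by apply: eq_bigr => j _; rewrite -scalerBr mxE mulrCA.
Qed.

Lemma near_segment x v (B : set 'rV[R]_d) : nbhs x B ->
  exists2 a : R, 0 < a < 1 & B (x + a *: v).
Proof.
move=> /nbhs_ballP[e /= e0 eB].
have D0 : 0 < e + `|v| + 1 by have := normr_ge0 v; lra.
(* The summand 1 keeps the ratio below 1 even for [v = 0], and the remaining summands make the ratio
   times the norm of [v] smaller than [e]. *)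
exists (e / (e + `|v| + 1)).
  rewrite divr_gt0//= ltr_pdivrMr// mul1r; have := normr_ge0 v; lra.
apply: eB; rewrite -ball_normE/= opprD addNKr normrN normrZ gtr0_norm ?divr_gt0//.
rewrite mulrAC ltr_pdivrMr// ltr_pM2l//; lra.
Qed.

End inner_product.

Section simplices.
Variables (R : realType) (d : nat) (T : triangulation R d).
Local Notation rv := 'rV[R]_d.
Local Notation simplex := {set 'I_(nvert T)}.
Implicit Types (K e : simplex).

Lemma barycentric_uniq K (s t : 'I_(nvert T) -> R) : K \in elts T ->
  \sum_(i in K) s i = \sum_(i in K) t i ->
  \sum_(i in K) s i *: vtx i = \sum_(i in K) t i *: vtx i ->
  forall i, i \in K -> s i = t i.
Proof.
move=> KT st sp i iK; apply/eqP; rewrite -subr_eq0; apply/eqP.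
have ind : affinely_independent (@vtx R d T) K by exact: elts_nondegenerate.
apply: (ind (fun i => s i - t i)) => //.
  by rewrite sumrB st subrr.
by under eq_bigr do rewrite scalerBl; rewrite sumrB sp subrr.
Qed.

(** The vertices extended by a last coordinate 1 are the rows of a square matrix of size [d + 1],
    which affine independence makes row-free, hence invertible. Multiplying the extended point
    [(x, 1)] by the inverse gives coordinates on the whole space, affine in [x] and possibly
    negative outside the element. *)
Lemma barycentric_exists K : K \in elts T ->
  exists lam : 'I_(nvert T) -> rv -> R, [/\ forall i, continuous (lam i),
    forall x, \sum_(i in K) lam i x = 1 &
    forall x, \sum_(i in K) lam i x *: vtx i = x].
Proof.
move=> KT; have cK := elts_card KT.
have [i0 i0K] : exists i, i \in K by apply/set0Pn; rewrite -card_gt0 cK.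
pose P : 'M[R]_(#|K|, d) := \matrix_j vtx (enum_val j).
pose V : 'M[R]_(#|K|, d + 1) := row_mx P (const_mx 1).
have PE (r : 'rV[R]_#|K|) :
    r *m P = \sum_(i in K) r 0 (enum_rank_in i0K i) *: vtx i.
  rewrite big_enum_val; apply/rowP => j; rewrite mxE summxE.
  by apply: eq_bigr => k _; rewrite enum_valK_in !mxE.
have cE (r : 'rV[R]_#|K|) : r *m (const_mx 1 : 'cV_#|K|)
    = (\sum_(i in K) r 0 (enum_rank_in i0K i))%:M.
  rewrite big_enum_val; apply/rowP => j; rewrite !ord1 !mxE mulr1n.
  by apply: eq_bigr => k _; rewrite enum_valK_in !mxE mulr1.
have freeV : row_free V.
  rewrite -kermx_eq0; apply/eqP/row_matrixP => k; rewrite row0.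
  have := mulmx_ker V; move/(congr1 (row k)); rewrite row_mul row0.
  move: (row k _) => r; rewrite /V mul_mx_row => rV.
  have [rP r1] : r *m P = 0 /\ r *m (const_mx 1 : 'cV_#|K|) = 0.
    by apply: (@eq_row_mx _ 1 d 1); rewrite rV row_mx0.
  have ind : affinely_independent (@vtx R d T) K by exact: elts_nondegenerate.
  apply/rowP => j; rewrite mxE -(enum_valK_in i0K j).
  apply: (ind (fun i => r 0 (enum_rank_in i0K i))).
  - by move/rowP : r1 => /(_ 0); rewrite cE !mxE.
  - by rewrite -PE.
  - exact: enum_valP.
have fullV : row_full V.
  move: freeV; rewrite /row_free/row_full => /eqP ->.
  by rewrite [X in X == _]cK addn1.
pose L (x : rv) : 'rV[R]_#|K| := row_mx x (1%:M : 'M[R]_1) *m pinvmx V.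
have LV x : L x *m V = row_mx x 1%:M by rewrite mulmxKpV// submx_full.
have LE x : L x *m P = x /\ L x *m (const_mx 1 : 'cV_#|K|) = 1%:M.
  by apply: (@eq_row_mx _ 1 d 1); rewrite -mul_mx_row LV.
exists (fun i x => L x 0 (enum_rank_in i0K i)); split => [i|x|x].
- set j := enum_rank_in _ _.
  rewrite (_ : (fun _ => _) = fun x : rv =>
     (\sum_k x 0 k * usubmx (pinvmx V) k j) + dsubmx (pinvmx V) 0 j).
    move=> x; apply: continuousD; last exact: cst_continuous.
    apply: (@continuous_big R _ +%R 0 predT) => [|k _ {}x].
      exact: add_continuous.
    by apply: continuousM; [exact: coord_continuous|exact: cst_continuous].
  apply/funext => x; rewrite /L -[in LHS](vsubmxK (pinvmx V)) mul_row_col mul1mx.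
  by rewrite mxE [in LHS]mxE.
- by have [_] := LE x; rewrite cE => /matrixP/(_ 0 0); rewrite !mxE !mulr1n.
- by rewrite -PE; have [] := LE x.
Qed.

Lemma sum_extend_by_zero (V : nmodType) K e (f : 'I_(nvert T) -> V) : e \subset K ->
  \sum_(i in K) (if i \in e then f i else 0) = \sum_(i in e) f i.
Proof.
move=> eK; rewrite -big_mkcondr; apply: eq_bigl => i.
by apply: andb_idl => ie; exact: (fintype.subsetP eK).
Qed.

Lemma hullS K e : e \subset K -> hull (@vtx R d T) e `<=` hull (@vtx R d T) K.
Proof.
move=> eK x [t [t0 t1 ->]]; exists (fun i => if i \in e then t i else 0); split.
- by move=> i; case: ifP.
- by rewrite sum_extend_by_zero.
- rewrite -(sum_extend_by_zero _ eK); apply: eq_bigr => i _.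
  by case: ifP; rewrite ?scale0r.
Qed.

Lemma cell_barycentric K lam : K \in elts T ->
  (forall x, \sum_(i in K) lam i x = 1) ->
  (forall x, \sum_(i in K) lam i x *: vtx i = x) ->
  cell K = [set x | forall i, i \in K -> 0 <= lam i x].
Proof.
move=> KT l1 lx; apply/seteqP; split => x /=.
  move=> [t [t0 t1 xt]] i iK.
  suff -> : lam i x = t i by exact: t0.
  apply: (barycentric_uniq (s := fun i => lam i x) KT) => //.
    by rewrite l1.
  by rewrite lx.
(* [hull] asks for nonnegative weights at all vertex indices, not only at those of [K]. *)
move=> h; exists (fun i => if i \in K then lam i x else 0); split.
- by move=> i; case: ifP => // /h.
- by rewrite sum_extend_by_zero ?l1.
- rewrite -[LHS]lx; apply: eq_bigr => i iK; by rewrite iK.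
Qed.

Lemma closed_cell K : K \in elts T -> closed (cell K).
Proof.
move=> KT; have [lam [lc l1 lx]] := barycentric_exists KT.
rewrite (cell_barycentric KT l1 lx).
rewrite (_ : [set _ | _] = \bigcap_(i in [set` K]) (lam i) @^-1` [set y | 0 <= y]);
  last by apply/seteqP; split.
apply: closed_bigI => i _; apply: closed_comp => [x _|]; first exact: lc.
exact: closed_ge.
Qed.

Lemma compact_cell K : K \in elts T -> compact (cell K).
Proof.
move=> KT; apply: bounded_closed_compact; last exact: closed_cell.
exists (\sum_(i in K) `|vtx i : rv|); split; first exact: num_real.
move=> M ltM x [t [t0 t1 ->]]; apply: le_trans (ltW ltM).
apply: le_trans (ler_norm_sum _ _ _) _; apply: ler_sum => i iK.
rewrite normrZ ler_piMl// ger0_norm// -t1 (bigD1 i)//= lerDl.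
exact: sumr_ge0.
Qed.

(** Moving a point slightly towards the barycentre of the element makes all its barycentric
    coordinates positive, and positivity persists in a neighbourhood because the coordinates are
    continuous. *)
Lemma cell_sub_closure_interior K : K \in elts T -> cell K `<=` closure (cell K)°.
Proof.
move=> KT x [t [t0 t1 xt]] B Bx.
have [lam [lc l1 lx]] := barycentric_exists KT.
have cK0 : (#|K|%:R : R) != 0 by rewrite pnatr_eq0 (elts_card KT).
pose b : rv := #|K|%:R^-1 *: \sum_(i in K) vtx i.
have [a /andP[a0 a1] Ba] := near_segment (b - x) Bx.
pose y : rv := x + a *: (b - x); exists y; split => //.
have yE i : i \in K -> lam i y = (1 - a) * t i + a * #|K|%:R^-1.
  move=> iK; apply: (barycentric_uniq (s := fun i => lam i y)
      (t := fun i => (1 - a) * t i + a * #|K|%:R^-1) KT) => //.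
    rewrite l1 big_split/= -!mulr_sumr t1 sumr_const.
    by rewrite -[_^-1 *+ _]mulr_natr mulVf// !mulr1 subrK.
  rewrite lx /y; under eq_bigr do rewrite scalerDl -!scalerA.
  rewrite big_split/= -!scaler_sumr -xt -/b scalerBr scalerBl scale1r.
  by rewrite addrA addrAC.
have y0 i : i \in K -> 0 < lam i y.
  move=> /yE ->; rewrite ltr_wpDl//; first by rewrite mulr_ge0// subr_ge0 ltW.
  by rewrite mulr_gt0// invr_gt0 lt0r cK0 ler0n.
rewrite /interior (cell_barycentric KT l1 lx)/=.
suff : \forall z \near y, forall i, i \in K -> 0 < lam i z.
  by apply: filterS => z h i /h /ltW.
apply: (@filter_forall rv _ (fun i z => i \in K -> 0 < lam i z)
  (nbhs y) (nbhs_filter y)) => i.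
case: (boolP (i \in K)) => [iK|_]; last first.
  by apply: nearW.
have : \forall z \near y, 0 < lam i z by apply: (cvgr_gt _ (lc i y)); exact: y0.
by apply: filterS.
Qed.

(** [int_face] integrates over the reference simplex, while sign conditions are imposed on closed
    elements; this transfers them to the integrands on faces. *)
Lemma face_point_in_cell K e (t : 'rV[R]_d.-1) : e \subset K -> #|e| = d ->
  (0 < d)%N -> ref_simplex t -> cell K (face_vtx e 0 + t *m face_edges e).
Proof.
move=> eK ce d0 [t0 t1]; apply: (hullS eK).
have [i0 i0e] : exists i, i \in e by apply/set0Pn; rewrite -card_gt0 ce.
pose tn k : R := if insub k is Some j then t 0 j else 0.
have tn0 k : 0 <= tn k by rewrite /tn; case: insub => // j; exact: t0.
have tnE (j : 'I_d.-1) : tn j = t 0 j by rewrite /tn valK.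
(* For [i] outside [e] the index is the length [d] of the enumeration, so [k = d.-1] is out of range
   for ['I_d.-1] and [tn k] takes its default 0: the weights are nonnegative at all vertices. *)
pose s i := if index i (enum e) is k.+1 then tn k else 1 - \sum_j t 0 j.
have sumE (V : nmodType) (f : 'I_(nvert T) -> V) : \sum_(i in e) f i =
    f (nth i0 (enum e) 0) + \sum_(k < d.-1) f (nth i0 (enum e) k.+1).
  rewrite -big_enum (big_nth i0) -cardE ce -{1}(prednK d0) big_mkord.
  by rewrite big_ord_recl; congr (_ + _).
have vE k : (k < d)%N -> face_vtx e k = vtx (nth i0 (enum e) k).
  by move=> kd; rewrite /face_vtx (nth_map i0)// -cardE ce.
have iE k : (k < d)%N -> index (nth i0 (enum e) k) (enum e) = k.
  by move=> kd; rewrite index_uniq ?enum_uniq// -cardE ce.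
have ltS (k : 'I_d.-1) : (k.+1 < d)%N by rewrite -ltn_predRL.
have s0 : s (nth i0 (enum e) 0) = 1 - \sum_j t 0 j by rewrite /s iE.
have sS (k : 'I_d.-1) : s (nth i0 (enum e) k.+1) = t 0 k by rewrite /s iE// tnE.
exists s; split.
- by move=> i; rewrite /s; case: index => //; rewrite subr_ge0.
- by rewrite sumE /= s0; under eq_bigr do rewrite sS; rewrite subrK.
- rewrite sumE /= s0 -vE// scalerBl scale1r -addrA; congr (_ + _).
  under [in RHS]eq_bigr do rewrite sS -vE//.
  rewrite scaler_suml addrC -sumrB; apply/rowP => j; rewrite mxE summxE.
  by apply: eq_bigr => k _; rewrite !mxE mulrBr.
Qed.

End simplices.

(** * Faces and normals *)

Section faces.
Variables (R : realType) (d : nat) (T : triangulation R d).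
Hypothesis d0 : (0 < d)%N.
Local Notation rv := 'rV[R]_d.
Local Notation simplex := {set 'I_(nvert T)}.
Implicit Types (K e : simplex).

Lemma elts_at_vertex K e : #|e| = d -> K \in elts_at e ->
  [/\ K \in elts T, e \subset K & exists2 a, a \notin e & K = a |: e].
Proof.
rewrite inE => ce /andP[KT eK]; split => //.
have : #|K :\: e| == 1%N.
  by rewrite cardsD (finset.setIidPr eK) ce (elts_card KT) subSnn.
move=> /cards1P[a Ka]; have : a \in K :\: e by rewrite Ka inE.
rewrite inE => /andP[ae aK]; exists a => //.
by rewrite -(finset.setID K e) (finset.setIidPr eK) Ka finset.setUC.
Qed.

(** The combination [z] of the two normals is orthogonal to every edge of [K] issuing from [i0].
    These edges span the space, so [z] pairs to 0 with itself and vanishes. The normals are thus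
    parallel, and unit length together with the common negative sign of [c] and [c'] makes them
    equal. *)
Lemma outer_normal_uniq K e n n' : #|e| = d -> K \in elts_at e ->
  is_outer_normal K e n -> is_outer_normal K e n' -> n = n'.
Proof.
move=> ce Ke [n1 no nK] [n1' no' nK'].
have [KT eK [a ae KE]] := elts_at_vertex ce Ke.
have [i0 i0e] : exists i, i \in e by apply/set0Pn; rewrite -card_gt0 ce.
have aKe : a \in K :\: e by rewrite KE !inE eqxx ae.
have := nK i0 a i0e aKe; have := nK' i0 a i0e aKe.
set c := dotv n (vtx a - vtx i0); set c' := dotv n' (vtx a - vtx i0) => c'0 c0.
pose z := c' *: n + (- c) *: n'.
have zp i : i \in K -> dotv z (vtx i - vtx i0) = 0.
  rewrite KE in_setU1 => /orP[/eqP ->|ie]; rewrite /z dotv_linl.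
    by rewrite -/c -/c'; ring.
  by rewrite no// no'// !mulr0 addr0.
have [lam [_ l1 lx]] := barycentric_exists KT.
have : dotv z z = 0.
  rewrite -[X in dotv z X](addrK (vtx i0)) -(lx (z + vtx i0)) dotv_affine//.
  by rewrite big1// => i iK; rewrite zp// mulr0.
move=> /dotv_eq0; rewrite /z scaleNr => /eqP; rewrite subr_eq0 => /eqP cn.
have nn m : normv m = 1 -> dotv m m = 1.
  by move=> h; rewrite -[LHS]sqr_sqrtr ?dotv_ge0// -/(normv m) h expr1n.
have cc : c' = c.
  apply: oppr_inj; apply: (@pexpIrn _ 2) => //; rewrite ?nnegrE ?oppr_ge0 ?ltW//.
  rewrite !sqrrN; have : dotv (c' *: n) (c' *: n) = dotv (c *: n') (c *: n').
    by rewrite cn.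
  have E (m : rv) k : dotv (k *: m) (k *: m) = k ^+ 2 * dotv m m.
    have := dotv_linl k 0 (k *: m) m m; rewrite !scale0r !addr0 => ->.
    by have := dotv_linr k 0 m m m; rewrite !scale0r !addr0 => ->; ring.
  by rewrite !E !nn// !mulr1.
by move: cn; rewrite cc => /scalerI; apply; rewrite lt_eqF.
Qed.

(* If the second vertex [b] were on the same side of the face as [a], a point
   of the segment from the barycentre of [e] to [b] would lie in both elements,
   hence by conformity in the face [e], which is absurd. *)
Lemma opposite_outer_normal K1 K2 e n : #|e| = d ->
  K1 \in elts_at e -> K2 \in elts_at e -> K1 != K2 ->
  is_outer_normal K1 e n -> is_outer_normal K2 e (- n).
Proof.
move=> ce Ke1 Ke2 K12 [n1 no nK].
have [KT1 eK1 [a ae KE1]] := elts_at_vertex ce Ke1.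
have [KT2 eK2 [b be KE2]] := elts_at_vertex ce Ke2.
split.
- rewrite /normv dotvNl dotvC dotvNl opprK; exact: n1.
- by move=> i j ie je; rewrite dotvNl no ?oppr0.
move=> i j ie; rewrite KE2 !inE => /andP[je].
rewrite (negPf je) orbF => /eqP -> {j je}.
rewrite dotvNl oppr_lt0.
have aK1e : a \in K1 :\: e by rewrite KE1 !inE eqxx ae.
have ca := nK i a ie aK1e.
have [lam [_ l1 lx]] := barycentric_exists KT1.
(* As [n] annihilates the directions of the face, only the coordinate at [a] contributes: the side
   on which [b] lies is read off the sign of [lam a (vtx b)]. *)
have <- : lam a (vtx b) * dotv n (vtx a - vtx i) = dotv n (vtx b - vtx i).
  rewrite -[X in _ = dotv n (X - _)](lx (vtx b)) dotv_affine// KE1 big_setU1//= big1.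
    by rewrite addr0.
  by move=> j je; rewrite no// mulr0.
rewrite nmulr_lgt0// ltNge; apply/negP => ta.
have bK1 : b \notin K1.
  apply: contra K12 => bK1; rewrite eq_sym eqEcard (elts_card KT1) (elts_card KT2).
  by rewrite leqnn andbT KE2 finset.subUset finset.sub1set bK1.
(* The point [x] below has weight [dl] at [b] and [M * dl] at each of the [d] vertices of the face;
   [dl] is fixed by total weight 1. Since [M] dominates each coordinate of [b] along the face,
   rewriting [b] in the coordinates of [K1] leaves all weights nonnegative. *)
pose M : R := \sum_(j in e) `|lam j (vtx b)|.
have M0 : 0 <= M by apply: sumr_ge0.
have dM0 : 0 < 1 + d%:R * M by rewrite ltr_pwDl// mulr_ge0.
pose dl := (1 + d%:R * M)^-1.
have dl0 : 0 < dl by rewrite invr_gt0.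
have tot : d%:R * (M * dl) + dl = 1.
  by rewrite mulrA -[X in _ + X]mul1r -mulrDl addrC mulfV// gt_eqF.
pose s j := if j == b then dl else if j \in e then M * dl else 0.
have s0 j : 0 <= s j.
  rewrite /s; case: ifP => _; first exact: ltW.
  by case: ifP => _ //; rewrite mulr_ge0// ltW.
have se (V : nmodType) (g : R -> 'I_(nvert T) -> V) :
    \sum_(j in e) g (s j) j = \sum_(j in e) g (M * dl) j.
  apply: eq_bigr => j je; rewrite /s je; case: eqP => // jb.
  by move: be; rewrite -jb je.
pose x := \sum_(j in K2) s j *: vtx j.
have sK2 : \sum_(j in K2) s j = 1.
  rewrite KE2 big_setU1//= (se _ (fun r _ => r)) sumr_const ce /s eqxx addrC.
  by rewrite -[_ *+ _]mulr_natl.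
have xK2 : cell K2 x by exists s.
have xE : x = dl *: vtx b + \sum_(j in e) (M * dl) *: vtx j.
  by rewrite /x KE2 big_setU1//= (se _ (fun r j => r *: vtx j)) /s eqxx.
have xK1 : cell K1 x.
  pose s1 j := if j == a then dl * lam a (vtx b)
    else if j \in e then M * dl + dl * lam j (vtx b) else 0.
  have s1e (V : nmodType) (g : R -> 'I_(nvert T) -> V) : \sum_(j in e) g (s1 j) j =
      \sum_(j in e) g (M * dl + dl * lam j (vtx b)) j.
    apply: eq_bigr => j je; rewrite /s1 je; case: eqP => // ja.
    by move: ae; rewrite -ja je.
  exists s1; split.
  - move=> j; rewrite /s1; case: ifP => _; first by rewrite mulr_ge0// ltW.
    case: ifP => // je; rewrite mulrC -mulrDr mulr_ge0 ?(ltW dl0)//.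
    have : `|lam j (vtx b)| <= M.
      by rewrite /M (bigD1 j)//= lerDl; apply: sumr_ge0.
    have := ler_norm (- lam j (vtx b)); rewrite normrN; lra.
  - rewrite KE1 big_setU1//= (s1e _ (fun r _ => r)) /s1 eqxx big_split/=.
    rewrite sumr_const ce -mulr_sumr addrCA -mulrDr.
    have := l1 (vtx b); rewrite KE1 big_setU1//= => ->.
    by rewrite mulr1 -[_ *+ _]mulr_natl.
  - rewrite KE1 big_setU1//= (s1e _ (fun r j => r *: vtx j)) /s1 eqxx xE.
    rewrite -[in LHS](lx (vtx b)) KE1 big_setU1//= scalerDr scalerA -addrA.
    congr (_ + _); rewrite scaler_sumr -big_split/=.
    by apply: eq_bigr => j _; rewrite scalerA -scalerDl addrC.
(* Conformity expresses [x] by the common vertices alone. Since [b] is not among them, the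
   coordinate of [x] at [b] would be 0, whereas in [K2] it is [dl]. *)
have : (cell K1 `&` cell K2) x by [].
rewrite /cell elts_conforming// => -[t [t0 t1 xt]].
have bK2 : b \in K2 by rewrite KE2 !inE eqxx.
have := barycentric_uniq (s := fun j => if j \in K1 :&: K2 then t j else 0)
  (t := s) KT2 _ _ bK2.
rewrite inE (negPf bK1)/= /s eqxx => h.
suff : 0 = dl by move=> E0; move: dl0; rewrite -E0 ltxx.
apply: h; first by rewrite sum_extend_by_zero ?t1 ?sK2// finset.subsetIr.
have -> : \sum_(j in K2) (if j \in K1 :&: K2 then t j else 0) *: vtx j =
    \sum_(j in K2) (if j \in K1 :&: K2 then t j *: vtx j else 0).
  by apply: eq_bigr => j _; case: ifP; rewrite ?scale0r.
by rewrite sum_extend_by_zero ?finset.subsetIr// -xt.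
Qed.

Lemma sum_normals_interior_face e : e \in faces_int T ->
  \sum_(K in elts_at e) normal K e = 0.
Proof.
rewrite inE => /andP[/eqP ce /cards2P[K1 [K2 [K12 eE]]]].
have Ke1 : K1 \in elts_at e by rewrite eE !inE eqxx.
have Ke2 : K2 \in elts_at e by rewrite eE !inE eqxx orbT.
rewrite eE big_setU1 ?inE//= big_set1.
have op12 n := @opposite_outer_normal K1 K2 e n ce Ke1 Ke2 K12.
have op21 n : is_outer_normal K2 e n -> is_outer_normal K1 e (- n).
  by apply: opposite_outer_normal => //; rewrite eq_sym.
(* Outer normals exist for both elements or for neither. In the first case uniqueness makes the two
   chosen ones opposite; in the second both are the default 0 of [xget]. *)
have [[n nK1]|no] := pselect (exists n, is_outer_normal K1 e n).
  have h1 : is_outer_normal K1 e (normal K1 e) by apply: xgetPex; exists n.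
  have h2 : is_outer_normal K2 e (normal K2 e).
    by apply: xgetPex; exists (- n); exact: op12.
  by rewrite (outer_normal_uniq ce Ke2 h2 (op12 _ h1)) subrr.
rewrite /normal !xgetPN ?addr0// => n h; apply: no.
  by exists (- n); exact: op21.
by exists n.
Qed.

Lemma jump_one_field e x : e \in faces_int T -> jump (@one_field R d T) e x = 0.
Proof.
move=> /sum_normals_interior_face <-.
by apply: eq_bigr => K _; rewrite scale1r.
Qed.

(** The point is the barycentre [m] of the face. If [m] were interior, points slightly beyond it, on
    the side away from the opposite vertex [a], would lie in some element [K']. Elements are closed
    and finite in number, so [K'] contains [m]; all coordinates of [m] on the face are positive, so
    by conformity [K'] contains the face, and [K' = K]. But such a point has coordinate [- dl] at
    [a]. *)
Lemma boundary_face_point K e (Om : set rv) : exactly_triangulates T Om ->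
  e \in faces_bd T -> K \in elts_at e -> exists2 m, cell K m & ~ Om m.
Proof.
move=> hT + Ke; rewrite inE => /andP[/eqP ce /cards1P[K0 eE]].
have eK0 K' : K' \in elts T -> e \subset K' -> K' = K.
  move=> KT' eK'; have : K' \in elts_at e by rewrite inE KT' eK'.
  by move: Ke; rewrite eE !inE => /eqP -> /eqP ->.
have [KT eK [a ae KE]] := elts_at_vertex ce Ke.
have dn0 : d%:R != 0 :> R by rewrite pnatr_eq0 -lt0n.
pose s i : R := if i \in e then d%:R^-1 else 0.
have s1 : \sum_(i in K) s i = 1.
  by rewrite sum_extend_by_zero// sumr_const ce -[_ *+ _]mulr_natl mulfV.
pose m : rv := \sum_(i in K) s i *: vtx i.
have mK : cell K m.
  by exists s; split => // i; rewrite /s; case: ifP; rewrite ?invr_ge0.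
exists m => // Omm.
have near_m : \forall x \near m,
    forall K', ~ (K' \in elts T /\ ~ cell K' m /\ cell K' x).
  apply: (@filter_forall rv _
    (fun K' x => ~ (K' \in elts T /\ ~ cell K' m /\ cell K' x)) 
    (nbhs m) (nbhs_filter m)).
  move=> K'.
  have [[KT' mK']|h] := pselect (K' \in elts T /\ ~ cell K' m); last first.
    by apply: nearW => x [h1 [h2 _]]; apply: h.
  have : nbhs m (~` cell K').
    by apply: open_nbhs_nbhs; split => //; apply: closed_openC; exact: closed_cell.
  by apply: filterS => x h [_ [_ /h]].
have Om_m : nbhs m (\bigcup_(K' in [set` elts T]) cell K').
  by move: Omm; rewrite hT.
have [dl /andP[dl0 _]] := near_segment (m - vtx a) (filterI near_m Om_m).
set x := m + _ => -[h [K' KT' xK']].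
have mK' : cell K' m by apply: contrapT => mK'; exact: (h K').
have K'K : K' = K.
  apply: eK0 => //; apply/fintype.subsetP => i ie.
  have : (cell K `&` cell K') m by [].
  rewrite /cell elts_conforming// => -[t [t0 t1 mt]].
  have iK : i \in K by exact: (fintype.subsetP eK).
  apply: contraT => iK'.
  have := barycentric_uniq (s := fun j => if j \in K :&: K' then t j else 0)
    (t := s) KT _ _ iK.
  rewrite inE (negPf iK') andbF /s ie => E0.
  suff /eqP : 0 = d%:R^-1 :> R by rewrite eq_sym invr_eq0 (negPf dn0).
  apply: E0; first by rewrite sum_extend_by_zero ?t1 ?s1// finset.subsetIl.
  have -> : \sum_(j in K) (if j \in K :&: K' then t j else 0) *: vtx j =
      \sum_(j in K) (if j \in K :&: K' then t j *: vtx j else 0).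
    by apply: eq_bigr => j _; case: ifP; rewrite ?scale0r.
  by rewrite sum_extend_by_zero ?finset.subsetIl// -mt.
rewrite K'K in xK'; case: xK' => t [t0 t1 xt].
have aK : a \in K by rewrite KE !inE eqxx.
pose s' i := (1 + dl) * s i - dl * (i == a)%:R.
have suma (V : nmodType) (g : 'I_(nvert T) -> V) :
    \sum_(i in K) (if i == a then g i else 0) = g a.
  rewrite (bigD1 a)//= eqxx big1 ?addr0// => i /andP[_ /negPf ->] //.
have := barycentric_uniq (s := t) (t := s') KT _ _ aK.
rewrite /s' /s (negPf ae) eqxx mulr0 mulr1 sub0r => E0.
suff : t a = - dl by have := t0 a; lra.
apply: E0.
  rewrite t1 sumrB -!mulr_sumr -/s.
  have -> : \sum_(i in K) (i == a)%:R = 1 :> R.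
    rewrite -[RHS](suma R (fun=> 1)); apply: eq_bigr => i _.
    by case: eqP.
  by rewrite s1; ring.
rewrite -xt; under eq_bigr do rewrite scalerBl -!scalerA.
rewrite sumrB -!scaler_sumr -/m.
have -> : \sum_(i in K) (i == a)%:R *: vtx i = vtx a :> rv.
  rewrite -[RHS](suma rv (@vtx R d T)); apply: eq_bigr => i _.
  by case: eqP => _; rewrite ?scale1r ?scale0r.
by rewrite /x scalerDl scale1r scalerBr addrA.
Qed.

Lemma assemble_ge (w : pw_field T R) K x : K \in elts T -> (cell K)° x ->
  values_in w [set t | 0 <= t] -> w K x <= assemble w x.
Proof.
move=> KT Kx w0; rewrite /assemble (bigD1 K)//= indicE mem_set// mul1r lerDl.
apply: sumr_ge0 => K' /andP[KT' _]; rewrite indicE.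
case: (boolP (_ \in _)) => [xK'|_]; last by rewrite mul0r.
by rewrite mul1r; apply: w0 => //; apply: interior_subset; exact: set_mem.
Qed.

(** A positive constant on [K] would put the interior of [K], hence its closure and with it all of
    [cell K], into the support. But [cell K] contains a point outside [Om]. *)
Lemma compactly_supported_boundary_element (w : pw_field T R) K e (Om : set rv) :
  exactly_triangulates T Om -> DG 0 w -> values_in w [set t | 0 <= t] ->
  compactly_supported Om (assemble w) ->
  e \in faces_bd T -> K \in elts_at e -> w K = fun=> 0.
Proof.
move=> hT w0 wge [_ sO] ebd Ke; have := Ke; rewrite inE => /andP[KT _].
have [a wa] := polynomial_le0 (w0 K KT).
rewrite wa; have [m mK nO] := boundary_face_point hT ebd Ke.
have a0 : 0 <= a by have := wge K KT m mK; rewrite wa.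
have [->//|an0] := eqVneq a 0.
exfalso; apply: nO; apply: sO.
have : closure (cell K)° m by exact: cell_sub_closure_interior.
apply: closureS => x xK /=; rewrite gt_eqF//.
apply: lt_le_trans (assemble_ge KT xK wge); rewrite wa lt0r an0//.
Qed.

End faces.

(** * Divided differences *)

Lemma continuous_pair (X Y Z : topologicalType) (f : X -> Y) (g : X -> Z) x :
  {for x, continuous f} -> {for x, continuous g} ->
  {for x, continuous (fun y => (f y, g y))}.
Proof.
move=> cf cg.
exact: (@cvg_pair _ _ _ (nbhs x) (nbhs (f x)) (nbhs (g x)) _ _ _ _ _ cf cg).
Qed.

Section divided_differences.
Variable R : realType.
Implicit Types (eps : R -> R -> R) (I J : set R).

(** [delta2] is [delta1] of the energy with exchanged arguments, so this symmetry carries every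
    result on [delta1] over to [delta2]. *)
Lemma C1_on_swap eps I J : C1_on eps I J -> C1_on (fun s r => eps r s) J I.
Proof.
move=> h s r Js Ir; have [d1 d2 c1 c2] := h r s Ir Js.
have sw : {for (s, r), continuous (fun z : R * R => (z.2, z.1))}.
  exact: swap_continuous.
split; [exact: d2|exact: d1| |].
  exact: (continuous_comp sw c2).
exact: (continuous_comp sw c1).
Qed.

Section box.
Variables (eps : R -> R -> R) (I J : set R) (a b a' b' : R).
Hypotheses (epsC1 : C1_on eps I J) (ab : a <= b) (ab' : a' <= b').
Hypotheses (abI : `[a, b] `<=` I) (abJ : `[a', b'] `<=` J).

Lemma derive1_bounded_box : exists M : R, forall r s,
  a <= r <= b -> a' <= s <= b' -> `|derive1 (eps ^~ s) r| <= M.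
Proof.
pose f (z : R * R) := derive1 (eps ^~ z.2) z.1.
pose A := `[a, b]%classic `*` `[a', b']%classic.
have A0 : A !=set0 by exists (a, a'); split; rewrite /= in_itv/= lexx.
have cA : compact A by apply: compact_setX; exact: segment_compact.
have cf : {within A, continuous f}.
  apply: continuous_in_subspaceT => -[r s]; rewrite inE => -[/= ra sa].
  by have [] := epsC1 (abI ra) (abJ sa).
have [z1 _ h1] := compact_EVT_max A0 cA cf.
have [z2 _ h2] := compact_EVT_min A0 cA cf.
exists (`|f z1| + `|f z2|) => r s hr hs.
have rsA : (r, s) \in A by rewrite inE; split; rewrite /= in_itv.
have f1 := h1 _ rsA; have f2 := h2 _ rsA.
change (`|f (r, s)| <= `|f z1| + `|f z2|).
have := ler_norm (f z1); have := ler_norm (- f z2); rewrite normrN.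
have := normr_ge0 (f z1); have := normr_ge0 (f z2).
by rewrite ler_norml => ? ? ? ?; apply/andP; split; lra.
Qed.

Lemma lipschitz_box_le M r r' s :
  (forall r s, a <= r <= b -> a' <= s <= b' -> `|derive1 (eps ^~ s) r| <= M) ->
  a <= r <= b -> a <= r' <= b -> a' <= s <= b' -> r <= r' ->
  `|eps r' s - eps r s| <= M * `|r' - r|.
Proof.
move=> hM /andP[ar rb] /andP[ar' rb'] hs rr'.
have Js : J s by apply: abJ; rewrite /= in_itv.
have din x : a <= x <= b -> derivable (eps ^~ s) x 1.
  move=> hx; have Ix : I x by apply: abI; rewrite /= in_itv.
  by have [] := epsC1 Ix Js.
have [x|x|c cr ->] := @MVT_segment R (eps ^~ s) (derive1 (eps ^~ s)) r r' rr'.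
- rewrite in_itv/= => /andP[rx xr']; rewrite derive1E; apply/derivableP.
  by apply: din; apply/andP; split; lra.
- apply: derivable_within_continuous => {}x; rewrite in_itv/= => /andP[rx xr'].
  by apply: din; apply/andP; split; lra.
rewrite normrM ler_wpM2r//; apply: hM => //.
by move: cr; rewrite in_itv/= => /andP[? ?]; apply/andP; split; lra.
Qed.

Lemma lipschitz_box : exists2 M : R, 0 <= M & forall r r' s,
  a <= r <= b -> a <= r' <= b -> a' <= s <= b' ->
  `|eps r' s - eps r s| <= M * `|r' - r| /\ `|delta1 eps r r' s| <= M.
Proof.
have [M hM] := derive1_bounded_box.
have L r r' s : a <= r <= b -> a <= r' <= b -> a' <= s <= b' ->
    `|eps r' s - eps r s| <= M * `|r' - r|.
  move=> hr hr' hs; have [rr'|/ltW rr'] := leP r r'.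
    exact: lipschitz_box_le.
  by rewrite distrC (distrC r'); exact: lipschitz_box_le.
exists M => [|r r' s hr hr' hs].
  by apply: le_trans (hM a a' _ _); rewrite ?lexx ?ab ?ab'.
split; first exact: L.
rewrite /delta1; case: eqP => [_|/eqP rr']; first exact: hM.
rewrite normrM normfV ler_pdivrMr ?normr_gt0 ?subr_eq0//; exact: L.
Qed.

End box.

Section composition.
Variables (d : nat) (D : set 'rV[R]_d) (eps : R -> R -> R) (I J : set R).
Variables (a b a' b' : R).
Hypotheses (epsC1 : C1_on eps I J) (ab : a <= b) (ab' : a' <= b').
Hypotheses (abI : `[a, b] `<=` I) (abJ : `[a', b'] `<=` J) (oD : open D).

(** [C1_on] speaks of derivatives in one variable at a time. Joint continuity comes from the
    Lipschitz bounds in each variable, passing through the mixed point [(r y, s x)], which stays in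
    the box because the box is a product. *)
Lemma continuous_C1_comp (r s : 'rV[R]_d -> R) : continuous r -> continuous s ->
  (forall x, D x -> a <= r x <= b) -> (forall x, D x -> a' <= s x <= b') ->
  {in D, continuous (fun x => eps (r x) (s x))}.
Proof.
move=> cr cs rD sD.
suff cont (x : 'rV[R]_d) : D x ->
    {for x, continuous (fun x => eps (r x) (s x))}.
  by move=> x /set_mem; exact: cont.
move=> Dx; have [M M0 hM] := lipschitz_box epsC1 ab ab' abI abJ.
have [N N0 hN] := lipschitz_box (C1_on_swap epsC1) ab' ab abJ abI.
apply: (proj2 (@cvgrPdist_lt _ _ _ (nbhs x) (nbhs_filter x) _ _)) => e e0.
have MN : 0 < M + N + 1 by lra.
have e0' : 0 < e / (M + N + 1) by rewrite divr_gt0.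
have h (f : 'rV[R]_d -> R) : continuous f ->
    nbhs x [set y | `|f x - f y| < e / (M + N + 1)].
  move=> /(_ x) cf.
  exact: (proj1 (@cvgrPdist_lt _ _ _ (nbhs x) (nbhs_filter x) _ _) cf).
have hD : nbhs x D by exact: open_nbhs_nbhs.
suff : nbhs x [set y | `|eps (r x) (s x) - eps (r y) (s y)| < e] by [].
have Fx : Filter (nbhs x) := nbhs_filter x.
have H : nbhs x (D `&` ([set y | `|r x - r y| < e / (M + N + 1)] `&`
    [set y | `|s x - s y| < e / (M + N + 1)])).
  by apply: filterI => //; apply: filterI; exact: h.
apply: (@filterS _ (nbhs x) (nbhs_filter x) _ _ _ H) => y [Dy [/= ry sy]].
have [h1 _] := hM _ _ _ (rD _ Dy) (rD _ Dx) (sD _ Dx).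
have [h2 _] := hN _ _ _ (sD _ Dy) (sD _ Dx) (rD _ Dy).
have -> : eps (r x) (s x) - eps (r y) (s y) =
   (eps (r x) (s x) - eps (r y) (s x)) + (eps (r y) (s x) - eps (r y) (s y)) by ring.
apply: le_lt_trans (ler_normD _ _) _.
apply: (@le_lt_trans _ _ (M * (e / (M + N + 1)) + N * (e / (M + N + 1)))).
  by apply: lerD; [apply: le_trans h1 _|apply: le_trans h2 _];
    rewrite ler_wpM2l// ltW.
rewrite -mulrDl mulrA ltr_pdivrMr// mulrC ltr_pM2l//; lra.
Qed.

Lemma bounded_measurable_C1_comp (r s : 'rV[R]_d -> R) :
  continuous r -> continuous s ->
  (forall x, D x -> a <= r x <= b) -> (forall x, D x -> a' <= s x <= b') ->
  bounded_measurable D (fun x => eps (r x) (s x)).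
Proof.
move=> cr cs rD sD; split.
  by apply: continuous_measurable_row => //; exact: continuous_C1_comp.
have [M M0 hM] := lipschitz_box epsC1 ab ab' abI abJ.
have [N N0 hN] := lipschitz_box (C1_on_swap epsC1) ab' ab abJ abI.
exists (`|eps a a'| + M * (b - a) + N * (b' - a')) => x Dx.
have haa : a <= a <= b by rewrite lexx.
have haa' : a' <= a' <= b' by rewrite lexx.
have [h1 _] := hM _ _ _ haa (rD _ Dx) (sD _ Dx).
have [h2 _] := hN _ _ _ haa' (sD _ Dx) haa.
have -> : eps (r x) (s x) = eps a a' + (eps (r x) (s x) - eps a (s x))
   + (eps a (s x) - eps a a') by ring.
apply: le_trans (ler_normD _ _) _; apply: lerD; last first.
  apply: le_trans h2 _; rewrite ler_wpM2l//.
  by have /andP[? ?] := sD x Dx; rewrite ger0_norm; lra.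
apply: le_trans (ler_normD _ _) _; rewrite lerD2l.
apply: le_trans h1 _; rewrite ler_wpM2l//.
by have /andP[? ?] := rD x Dx; rewrite ger0_norm; lra.
Qed.

(** Measurability is checked on two pieces: where [r'] and [r] agree the function is a continuous
    partial derivative, and on the open set where they differ it is a continuous quotient. The mean
    value theorem bounds both by the same constant. *)
Lemma bounded_measurable_delta1 (r r' s : 'rV[R]_d -> R) :
  continuous r -> continuous r' -> continuous s ->
  (forall x, D x -> a <= r x <= b) -> (forall x, D x -> a <= r' x <= b) ->
  (forall x, D x -> a' <= s x <= b') ->
  bounded_measurable D (fun x => delta1 eps (r x) (r' x) (s x)).
Proof.
move=> cr cr' cs rD rD' sD; split; last first.
  have [M M0 hM] := lipschitz_box epsC1 ab ab' abI abJ.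
  by exists M => x Dx; have [] := hM _ _ _ (rD _ Dx) (rD' _ Dx) (sD _ Dx).
have mD : measurable D by exact: open_measurable_row.
have mc (f : 'rV[R]_d -> R) : continuous f -> measurable_fun D f.
  by move=> cf; apply: continuous_measurable_row => // x _; exact: cf.
apply: measurable_fun_if => //.
- by apply: measurable_fun_eqr; exact: mc.
- have : measurable_fun D (fun x => derive1 (eps ^~ (s x)) (r x)).
    apply: continuous_measurable_row => // x /set_mem Dx.
    have Ir : I (r x) by apply: abI; rewrite /= in_itv; exact: rD.
    have Js : J (s x) by apply: abJ; rewrite /= in_itv; exact: sD.
    have [_ _ + _] := epsC1 Ir Js.
    have crs : {for x, continuous (fun x => (r x, s x))}.
      by apply: continuous_pair; [exact: cr|exact: cs].
    exact: (continuous_comp crs).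
  by apply: measurable_funS => //; exact: subIsetl.
- have -> : D `&` (fun x => r' x == r x) @^-1` [set false] =
      D `&` [set x | r' x - r x != 0].
    by apply/seteqP; split => x /= [Dx]; rewrite subr_eq0;
      [move=> -> |move/negbTE].
  have c' : continuous (fun x => r' x - r x).
    by move=> x; apply: continuousB; [exact: cr'|exact: cr].
  apply: continuous_measurable_row.
    apply: openI => //.
    have o0 : open [set y : R | y != 0] by exact: open_neq.
    by apply: (open_comp _ o0) => x _; exact: c'.
  suff cont (x : 'rV[R]_d) : D x -> r' x - r x != 0 -> {for x, continuous
      (fun x => (eps (r' x) (s x) - eps (r x) (s x)) / (r' x - r x))}.
    by move=> x /set_mem[Dx /= rx]; exact: cont.
  move=> Dx rx; have xD : x \in D by exact: mem_set.
  apply: (@continuousM _ _ (fun x => eps (r' x) (s x) - eps (r x) (s x))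
    (fun x => (r' x - r x)^-1)); last by apply: continuousV => //; exact: c'.
  apply: continuousB.
    exact: (continuous_C1_comp cr' cs rD' sD xD).
  exact: (continuous_C1_comp cr cs rD sD xD).
Qed.

End composition.

End divided_differences.

Section element_range.
Variables (R : realType) (d : nat) (T : triangulation R d).

Lemma cell_neq0 (K : {set 'I_(nvert T)}) : K \in elts T -> cell K !=set0.
Proof.
move=> KT; have [i0 i0K] : exists i, i \in K.
  by apply/set0Pn; rewrite -card_gt0 (elts_card KT).
exists (vtx i0), (fun i => (i == i0)%:R); split.
- by move=> i; case: eqP.
- by rewrite (bigD1 i0)//= eqxx big1 ?addr0// => i /andP[_ /negPf ->].
- rewrite (bigD1 i0)//= eqxx scale1r big1 ?addr0// => i /andP[_ /negPf ->].
  by rewrite scale0r.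
Qed.

(** Bounds on [eps] are available only on compact boxes. The extreme values on the compact element
    provide one, and a single segment must serve both successive states because [delta1] joins their
    values. *)
Lemma values_in_segment (K : {set 'I_(nvert T)}) (I : set R) (f g : 'rV[R]_d -> R) :
  K \in elts T -> is_interval I -> continuous f -> continuous g ->
  (forall x, cell K x -> I (f x)) -> (forall x, cell K x -> I (g x)) ->
  exists a b, [/\ a <= b, `[a, b] `<=` I,
    forall x, cell K x -> a <= f x <= b & forall x, cell K x -> a <= g x <= b].
Proof.
move=> KT itvI cf cg fI gI.
have n0 := cell_neq0 KT; have cK := compact_cell KT.
have wf := @continuous_subspaceT _ _ (cell K) _ cf.
have wg := @continuous_subspaceT _ _ (cell K) _ cg.
have [x1 /set_mem K1 h1] := compact_EVT_min n0 cK wf.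
have [x2 /set_mem K2 h2] := compact_EVT_max n0 cK wf.
have [x3 /set_mem K3 h3] := compact_EVT_min n0 cK wg.
have [x4 /set_mem K4 h4] := compact_EVT_max n0 cK wg.
exists (Num.min (f x1) (g x3)), (Num.max (f x2) (g x4)).
have hf x : cell K x -> Num.min (f x1) (g x3) <= f x <= Num.max (f x2) (g x4).
  by move=> /mem_set Kx; rewrite ge_min le_max h1 ?h2.
split => //.
- by have /andP[h h'] := hf _ K1; exact: le_trans h h'.
- move=> y; rewrite /= in_itv/=; apply: itvI.
    by rewrite minEle; case: ifP => _; [exact: fI|exact: gI].
  by rewrite maxEle; case: ifP => _; [exact: gI|exact: fI].
- by move=> x /mem_set Kx; rewrite ge_min le_max h3 ?h4 ?orbT.
Qed.

End element_range.

(** * Integration over the mesh *)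

Section integral_Om.
Variables (R : realType) (d : nat) (Om : set 'rV[R]_d) (T : triangulation R d).
Hypotheses (bOm : bounded_domain Om) (hT : exactly_triangulates T Om).
Local Notation rv := 'rV[R]_d.
Local Notation mu := (lebesgue_row R d).
Local Notation simplex := {set 'I_(nvert T)}.
Implicit Types (K : simplex) (f g : pw_field T R).

Lemma bounded_lebesgue_row (A : set rv) : measurable A -> bounded_set A ->
  (mu A < +oo)%E.
Proof.
move=> mA [M [_ hM]].
have M1 : M < `|M| + 1 by have := ler_norm M; lra.
apply: le_lt_trans (@lebesgue_row_box R d (`|M| + 1) _); last by rewrite addr_ge0.
apply: le_measure.
- exact: mem_set.
- by apply: mem_set; exact: measurable_abs_box.
move=> x Ax i; apply: le_trans (hM _ M1 x Ax).
rewrite [leRHS]/Num.Def.normr /= mx_normrE.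
exact: (le_bigmax _ (fun ij : 'I_1 * 'I_d => `|x ij.1 ij.2|) (ord0, i)).
Qed.

Lemma measurable_Om : measurable Om.
Proof. by apply: open_measurable_row; case: bOm. Qed.

Lemma Om_finite : (mu Om < +oo)%E.
Proof. by apply: bounded_lebesgue_row; [exact: measurable_Om|case: bOm]. Qed.

Lemma open_cell_interior K : open (cell K)°.
Proof. exact: open_interior. Qed.

Lemma measurable_cell_interior K : measurable ((cell K)° : set rv).
Proof. by apply: open_measurable_row; exact: open_cell_interior. Qed.

Lemma cell_interior_sub_Om K : K \in elts T -> (cell K)° `<=` Om.
Proof.
move=> KT; rewrite [X in _ `<=` X]hT; apply: interiorS => x Kx.
by exists K.
Qed.

Lemma cell_interior_finite K : K \in elts T -> (mu (cell K)° < +oo)%E.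
Proof.
move=> KT; apply: le_lt_trans Om_finite.
by apply: le_measure; rewrite ?inE; [exact: measurable_cell_interior|
  exact: measurable_Om|exact: cell_interior_sub_Om].
Qed.

Definition pw_bounded_measurable f : Prop :=
  forall K, K \in elts T -> bounded_measurable (cell K)° (f K).

(** [assemble f] is a finite sum of functions cut off to the interiors of the elements, all of which
    lie in [Om], so linearity of the integral suffices. *)
Lemma int_OmE f : pw_bounded_measurable f ->
  int_Om Om f = \sum_(K in elts T) \int[mu]_(x in (cell K)°) f K x.
Proof.
move=> bf; pose F K : rv -> R := if K \in elts T then f K \_ (cell K)° else fun=> 0.
have bF K : bounded_measurable Om (F K).
  rewrite /F; case: ifPn => [KT|_]; last exact: (bounded_measurable_cst _ 0).
  have [mf [M hM]] := bf K KT; split.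
    apply/(measurable_restrict _ (measurable_cell_interior K) measurable_Om).
    by apply: measurable_funS mf; [exact: measurable_cell_interior|exact: subIsetr].
  exists `|M| => x _; rewrite patchE; case: ifPn => [/set_mem Kx|_].
    by apply: le_trans (hM x Kx) _; exact: ler_norm.
  by rewrite normr0.
rewrite /int_Om.
rewrite (_ : assemble f = fun x => \sum_K F K x); last first.
  apply/funext => x; rewrite /assemble big_mkcond; apply: eq_bigr => K _.
  rewrite /F; case: ifP => // _; rewrite patchE indicE.
  by case: (x \in _); rewrite ?mul1r ?mul0r.
rewrite bounded_measurable_integral_sum//; last 2 first.
- exact: measurable_Om.
- exact: Om_finite.
rewrite [RHS]big_mkcond; apply: eq_bigr => K _; rewrite /F; case: ifPn => KT.
  rewrite -Rintegral_mkcondr; congr Rintegral.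
  by apply/setIidPr; exact: cell_interior_sub_Om.
by rewrite Rintegral_cst ?mul0r//; exact: measurable_Om.
Qed.

Lemma pw_bounded_measurable_lin a b f g :
  pw_bounded_measurable f -> pw_bounded_measurable g ->
  pw_bounded_measurable (fun K x => a * f K x + b * g K x).
Proof.
move=> bf bg K KT; apply: bounded_measurableD; apply: bounded_measurableM;
  by [exact: bounded_measurable_cst|exact: bf|exact: bg].
Qed.

Lemma pw_bounded_measurableM f g :
  pw_bounded_measurable f -> pw_bounded_measurable g ->
  pw_bounded_measurable (fun K x => f K x * g K x).
Proof. by move=> bf bg K KT; apply: bounded_measurableM; [exact: bf|exact: bg]. Qed.

Lemma int_Om_lin a b f g :
  pw_bounded_measurable f -> pw_bounded_measurable g ->
  int_Om Om (fun K x => a * f K x + b * g K x) = a * int_Om Om f + b * int_Om Om g.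
Proof.
move=> bf bg; rewrite !int_OmE//; last exact: pw_bounded_measurable_lin.
rewrite !mulr_sumr -big_split; apply: eq_bigr => K KT /=.
rewrite bounded_measurable_integral_lin//.
- exact: measurable_cell_interior.
- exact: cell_interior_finite.
- exact: bf.
- exact: bg.
Qed.

Lemma continuous_bounded_measurable K (f : rv -> R) : K \in elts T ->
  continuous f -> bounded_measurable (cell K)° f.
Proof.
move=> KT cf; split.
  apply: continuous_measurable_row; first exact: open_cell_interior.
  by move=> x _; exact: cf.
have wf := @continuous_subspaceT _ _ (cell K) _ cf.
have [M [_ hM]] := compact_bounded (continuous_compact wf (compact_cell KT)).
exists (M + 1) => x /interior_subset Kx.
by apply: (hM (M + 1)); [lra|exists x].
Qed.

Lemma DG_bounded_measurable q f : DG q f -> pw_bounded_measurable f.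
Proof.
move=> hf K KT; apply: continuous_bounded_measurable => //.
by apply: continuous_polynomial_le; exact: hf.
Qed.

Lemma DG_lin q a b f g : DG q f -> DG q g -> DG q (fun K x => a * f K x + b * g K x).
Proof. by move=> hf hg K KT; apply: polynomial_le_lin; [exact: hf|exact: hg]. Qed.

(** Fields in [DG q] are independent from one element to the next, so orthogonality decouples and a
    projection is assembled from one set of normal equations per element. This existence is what
    gives the field picked by [xget] its defining property. *)
Lemma L2projP q f : pw_bounded_measurable f ->
  DG q (L2proj Om q f) /\
  forall v, DG q v -> inner Om v f = inner Om v (L2proj Om q f).
Proof.
move=> bf.
have ex K : exists c : {ffun 'I_d -> 'I_q.+1} -> R, K \in elts T ->
    forall m : {ffun 'I_d -> 'I_q.+1}, \int[mu]_(x in (cell K)°)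
      ((f K x - \sum_m' c m' * monomial m' x) * monomial m x) = 0.
  have [KT|_] := boolP (K \in elts T); last by exists (fun=> 0).
  have [|c hc] := orthogonal_projection_exists
    (measurable_cell_interior K) (cell_interior_finite KT)
    (e := @monomial R d q) _ (bf K KT).
    move=> m; apply: continuous_bounded_measurable => //.
    by apply: continuous_polynomial_le; exact: monomial_polynomial_le.
  by exists c.
have [c hc] := choice ex.
pose p : pw_field T R := fun K x => \sum_m c K m * monomial m x.
have [] : [set p : pw_field T R | DG q p /\
    forall v, DG q v -> inner Om (fun K x => f K x - p K x) v = 0]
    (L2proj Om q f).
  apply: xgetPex; exists p.
  have dp : DG q p by move=> K KT; apply/polynomial_leE; exists (c K).
  split => // v dv.
  have bp := DG_bounded_measurable dp.
  have bfp K : K \in elts T ->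
      bounded_measurable (cell K)° (fun x => f K x - p K x).
    by move=> KT; apply: bounded_measurableB; [exact: bf|exact: bp].
  rewrite /inner int_OmE => [|K KT]; last first.
    by apply: bounded_measurableM; [exact: bfp|exact: (DG_bounded_measurable dv)].
  apply: big1 => K KT.
  have /polynomial_leE[a ->] := dv K KT.
  have bm (m : {ffun 'I_d -> 'I_q.+1}) : bounded_measurable (cell K)°
      (fun x => (f K x - p K x) * monomial m x).
    apply: bounded_measurableM; first exact: bfp.
    apply: continuous_bounded_measurable => //.
    by apply: continuous_polynomial_le; exact: monomial_polynomial_le.
  transitivity (\int[mu]_(x in (cell K)°)
      \sum_m (a m * ((f K x - p K x) * monomial m x))).
    apply: eq_Rintegral => x _; rewrite mulr_sumr.
    by apply: eq_bigr => m _; rewrite mulrCA.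
  rewrite bounded_measurable_integral_sum; last first.
  - move=> m; apply: bounded_measurableM => //; exact: bounded_measurable_cst.
  - exact: cell_interior_finite.
  - exact: measurable_cell_interior.
  apply: big1 => m _; rewrite RintegralZl; last 2 first.
  - exact: measurable_cell_interior.
  - apply: bounded_measurable_integrable => //; last exact: cell_interior_finite.
    exact: measurable_cell_interior.
  by rewrite hc// mulr0.
move=> dp ort; split => // v dv; apply/eqP; rewrite -subr_eq0; apply/eqP.
have bv := DG_bounded_measurable dv; have bp := DG_bounded_measurable dp.
rewrite -(ort v dv) /inner.
have := int_Om_lin 1 (-1) (pw_bounded_measurableM bv bf)
  (pw_bounded_measurableM bv bp).
rewrite mul1r mulN1r => <-; congr int_Om; apply/funext => K; apply/funext => x.
ring.
Qed.

End integral_Om.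

(** * Midpoints in the velocity space *)

Section H10_midpoint.
Variables (R : realType) (d : nat).
Local Notation rv := 'rV[R]_d.
Implicit Types f g : rv -> R.

Lemma midpoint_funE f g :
  (fun x => 2^-1 * (f x + g x)) = 2^-1 *: (f + g).
Proof. by apply/funext. Qed.

Lemma partial_midpoint f g i :
  (forall x, differentiable f x) -> (forall x, differentiable g x) ->
  partial i (fun x => 2^-1 * (f x + g x))
  = fun x => 2^-1 * (partial i f x + partial i g x).
Proof.
move=> df dg; apply/funext => x; rewrite midpoint_funE /partial.
rewrite deriveZ; last by apply: derivableD; exact: diff_derivable.
by rewrite deriveD//; exact: diff_derivable.
Qed.

Lemma smooth_midpoint f g : smooth f -> smooth g ->
  smooth (fun x => 2^-1 * (f x + g x)).
Proof.
move=> sf sg s.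
have -> : foldr (@partial R d) (fun x => 2^-1 * (f x + g x)) s =
    fun x => 2^-1 * (foldr (@partial R d) f s x + foldr (@partial R d) g s x).
  by elim: s => [//|i s ih] /=; rewrite ih partial_midpoint.
move=> x; rewrite midpoint_funE; apply: differentiableZ; apply: differentiableD.
  exact: sf.
exact: sg.
Qed.

Lemma compactly_supported_midpoint (Om : set rv) f g :
  compactly_supported Om f -> compactly_supported Om g ->
  compactly_supported Om (fun x => 2^-1 * (f x + g x)).
Proof.
move=> [cf fO] [cg gO].
have sub : supp (fun x => 2^-1 * (f x + g x)) `<=` supp f `|` supp g.
  rewrite /supp -closureU; apply: closureS => x /=.
  have [->|] := eqVneq (f x) 0; last by left.
  have [->|] := eqVneq (g x) 0; last by right.
  by rewrite addr0 mulr0 eqxx.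
split; last by move=> x /sub[/fO|/gO].
by apply: subclosed_compact sub; [exact: closed_closure|exact: compactU].
Qed.

Lemma smooth_continuous f : smooth f -> continuous f.
Proof. by move=> sf x; apply: differentiable_continuous; exact: (sf [::]). Qed.

Lemma partial_continuous f i : smooth f -> continuous (partial i f).
Proof. by move=> sf x; apply: differentiable_continuous; exact: (sf [:: i]). Qed.

Section limit.
Variables (Om : set rv) (oOm : open Om) (a b : nat -> rv -> R) (f g : rv -> R).
Hypotheses (ca : forall n, continuous (a n)) (cb : forall n, continuous (b n)).
Hypotheses (mf : measurable_fun Om f) (mg : measurable_fun Om g).
Local Notation mu := (lebesgue_row R d).

(** The square of a mean of two errors is at most the sum of their squares, so the integrals are
    squeezed between 0 and a sum tending to 0. *)
Lemma L2_cvg_midpoint :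
  (\int[mu]_(x in Om) (((a n x - f x) ^+ 2)%:E))%E @[n --> \oo] --> 0%E ->
  (\int[mu]_(x in Om) (((b n x - g x) ^+ 2)%:E))%E @[n --> \oo] --> 0%E ->
  (\int[mu]_(x in Om)
    (((2^-1 * (a n x + b n x) - 2^-1 * (f x + g x)) ^+ 2)%:E))%E @[n --> \oo]
    --> 0%E.
Proof.
move=> ha hb.
have mOm : measurable Om by exact: open_measurable_row.
have mc (h : rv -> R) : continuous h -> measurable_fun Om h.
  by move=> ch; apply: continuous_measurable_row => // x _; exact: ch.
have msq (h k : rv -> R) : continuous h -> measurable_fun Om k ->
    measurable_fun Om (fun x => ((h x - k x) ^+ 2)%:E).
  move=> ch mk; apply/measurable_EFinP; apply: measurable_funX.
  by apply: measurable_funB => //; exact: mc.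
have sq0 (r : R) : (0 <= (r ^+ 2)%:E)%E by rewrite lee_fin sqr_ge0.
have := cvgeD _ ha hb; rewrite adde0 => /(_ _ isT) hab.
apply: (squeeze_cvge _ (cvg_cst 0%E) hab); apply: nearW => n.
apply/andP; split; first by apply: integral_ge0.
rewrite -ge0_integralD//; [|exact: msq|exact: msq].
apply: ge0_le_integral => //.
- apply/measurable_EFinP; apply: measurable_funX; apply: measurable_funB.
    apply: measurable_funM; first exact: measurable_cst.
    by apply: measurable_funD; exact: mc.
  by apply: measurable_funM; [exact: measurable_cst|exact: measurable_funD].
- by apply: emeasurable_funD; exact: msq.
- move=> x _; rewrite -EFinD lee_fin.
  have := sqr_ge0 (a n x - f x - (b n x - g x)).
  have := sqr_ge0 (a n x - f x); have := sqr_ge0 (b n x - g x).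
  nra.
Qed.

End limit.

Lemma H10_midpoint (Om : set rv) f g : open Om -> H10 Om f -> H10 Om g ->
  H10 Om (fun x => 2^-1 * (f x + g x)).
Proof.
move=> oOm [a [a' [[mf ma'] sa La La']]] [b [b' [[mg mb'] sb Lb Lb']]].
have mM (h k : rv -> R) : measurable_fun Om h -> measurable_fun Om k ->
    measurable_fun Om (fun x => 2^-1 * (h x + k x)).
  by move=> mh mk; apply: measurable_funM; [exact: measurable_cst|
    exact: measurable_funD].
exists (fun n x => 2^-1 * (a n x + b n x)), (fun i x => 2^-1 * (a' i x + b' i x)).
split.
- by split => [|i]; exact: mM.
- move=> n; have [sma coa] := sa n; have [smb cob] := sb n.
  by split; [exact: smooth_midpoint|exact: compactly_supported_midpoint].
- apply: L2_cvg_midpoint => // n; apply: smooth_continuous.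
    by have [] := sa n.
  by have [] := sb n.
- move=> i; under [X in X @ _ --> _]eq_fun => n.
    rewrite partial_midpoint; last 2 first.
    + by move=> x; have [/(_ [::])] := sa n.
    + by move=> x; have [/(_ [::])] := sb n.
    over.
  apply: L2_cvg_midpoint => // n; apply: partial_continuous.
    by have [] := sa n.
  by have [] := sb n.
Qed.

End H10_midpoint.

(** * Sign of the viscous dissipation *)

Section stress.
Variables (R : realType) (d : nat).

(** The contraction equals [mu * Q + lam * t ^+ 2]. Symmetrizing shows that [2 * Q] is a sum of
    squares; keeping its diagonal part gives [Q >= 2 * S], and [S >= t ^+ 2 / d] leaves exactly the
    assumed combination of [lam] and [mu]. *)
Lemma stress_dissipation_ge0 (mu lam : R) (A : 'M[R]_d) : (0 < d)%N ->
  0 <= mu -> 0 <= lam + 2 / d%:R * mu ->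
  0 <= ddot ((2 * mu) *: (2^-1 *: (A + A^T)) + (lam * \tr A)%:M) A.
Proof.
move=> d0 mu0 lam0.
have dn0 : 0 < d%:R :> R by rewrite ltr0n.
pose t := \tr A; pose S := \sum_i A i i ^+ 2.
pose Q := \sum_i \sum_j (A i j + A j i) * A i j.
have tE : t = \sum_i A i i by [].
rewrite -/t; move: t tE => t tE.
have -> : ddot ((2 * mu) *: (2^-1 *: (A + A^T)) + (lam * t)%:M) A
    = mu * Q + lam * t ^+ 2.
  have E i : \sum_j (mu * ((A i j + A j i) * A i j) + (lam * t) *+ (i == j) * A i j)
      = mu * \sum_j (A i j + A j i) * A i j + lam * t * A i i.
    rewrite big_split mulr_sumr; congr (_ + _).
    rewrite (bigD1 i)//= eqxx mulr1n big1 ?addr0// => j.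
    by rewrite eq_sym => /negPf ->; rewrite mulr0n mul0r.
  transitivity (\sum_i (mu * (\sum_j (A i j + A j i) * A i j) + lam * t * A i i)).
    apply: eq_bigr => i _; rewrite -E; apply: eq_bigr => j _.
    by rewrite !mxE; field.
  by rewrite big_split/= -!mulr_sumr -tE -/Q expr2 mulrA.
have QE : 2 * Q = \sum_i \sum_j (A i j + A j i) ^+ 2.
  have QE' : Q = \sum_i \sum_j (A i j + A j i) * A j i.
    rewrite /Q exchange_big; apply: eq_bigr => i _; apply: eq_bigr => j _.
    by rewrite addrC.
  rewrite (_ : 2 * Q = Q + Q); last by ring.
  rewrite {2}QE' /Q -big_split; apply: eq_bigr => i _.
  rewrite -big_split; apply: eq_bigr => j _ /=; ring.
have QS : 2 * S <= Q.
  suff : 4 * S <= 2 * Q by lra.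
  rewrite QE /S mulr_sumr; apply: ler_sum => i _; rewrite (bigD1 i)//=.
  have -> : 4 * A i i ^+ 2 = (A i i + A i i) ^+ 2 by ring.
  by rewrite lerDl; apply: sumr_ge0 => j _; exact: sqr_ge0.
have St : t ^+ 2 / d%:R <= S.
  (* The Cauchy-Schwarz inequality for the trace, obtained as nonnegativity of the variance of the
     diagonal entries. *)
  have : 0 <= \sum_i (A i i - t / d%:R) ^+ 2.
    by apply: sumr_ge0 => i _; exact: sqr_ge0.
  have -> : \sum_i (A i i - t / d%:R) ^+ 2 =
      \sum_i (A i i ^+ 2 + (- 2 * (t / d%:R)) * A i i + (t / d%:R) ^+ 2).
    by apply: eq_bigr => i _; ring.
  rewrite !big_split/= -mulr_sumr -tE sumr_const card_ord -/S.
  rewrite -[(t / d%:R) ^+ 2 *+ d]mulr_natl => h; rewrite -subr_ge0.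
  apply: le_trans h _; rewrite le_eqVlt; apply/orP; left; apply/eqP.
  by field; rewrite gt_eqF.
have h1 : 2 * mu * S <= mu * Q by rewrite mulrAC mulrC ler_wpM2l.
have h2 : 2 * mu * (t ^+ 2 / d%:R) <= 2 * mu * S by rewrite ler_wpM2l// mulr_ge0.
have h3 : 0 <= (lam + 2 / d%:R * mu) * t ^+ 2 by rewrite mulr_ge0// sqr_ge0.
have h4 : (lam + 2 / d%:R * mu) * t ^+ 2 = 2 * mu * (t ^+ 2 / d%:R) + lam * t ^+ 2.
  by ring.
lra.
Qed.

End stress.

(** * Balance laws *)

Section forms.
Variables (R : realType) (d : nat) (T : triangulation R d).
Local Notation rv := 'rV[R]_d.
Local Notation simplex := {set 'I_(nvert T)}.

Lemma Rintegral_eq0 n (D : set 'rV[R]_n) (f : 'rV[R]_n -> R) :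
  (forall x, D x -> f x = 0) -> \int[lebesgue_row R n]_(x in D) f x = 0.
Proof. by move=> h; rewrite /Rintegral integral0_eq// => x /h ->. Qed.

Lemma int_face_eq0 (e : simplex) (f : rv -> R) :
  (forall x, f x = 0) -> int_face e f = 0.
Proof. by move=> h; rewrite /int_face Rintegral_eq0 ?mulr0. Qed.

Lemma int_Om_eq0 (Om : set rv) (f : pw_field T R) :
  (forall K x, f K x = 0) -> int_Om Om f = 0.
Proof.
move=> h; apply: Rintegral_eq0 => x _; rewrite /assemble big1// => K _.
by rewrite h mulr0.
Qed.

Lemma form_b_one_field (rho : pw_field T R) (u : pw_field T rv) : (0 < d)%N ->
  form_b (@one_field R d T) rho u = 0.
Proof.
move=> d0; rewrite /form_b !big1 ?oppr0 ?addr0// => [e eint|K _].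
  by apply: int_face_eq0 => x; rewrite jump_one_field// dotv0 mul0r.
apply: Rintegral_eq0 => x _.
have -> : grad (@one_field R d T K) x = 0.
  by apply/rowP => i; rewrite !mxE /partial derive_cst.
by rewrite dotv0 mul0r.
Qed.

Lemma form_a_diag (Om : set rv) (w u : pw_field T rv) : form_a Om w u u = 0.
Proof.
rewrite /form_a int_Om_eq0 ?oppr0// => K x.
by rewrite /lie subrr dotv0.
Qed.

Lemma form_c_ge0 (Om : set rv) (mu lam : R) (w : pw_field T R)
    (u : pw_field T rv) : (0 < d)%N -> 0 <= mu -> 0 <= lam + 2 / d%:R * mu ->
  values_in w [set t | 0 <= t] -> 0 <= form_c Om mu lam w u u.
Proof.
move=> d0 mu0 lam0 w0; apply: Rintegral_ge0 => x _; apply: sumr_ge0 => K KT.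
rewrite indicE; case: (boolP (_ \in _)) => [/set_mem/interior_subset Kx|_].
  by rewrite mul1r mulr_ge0//; [exact: w0|exact: stress_dissipation_ge0].
by rewrite mul0r.
Qed.

Lemma diam_ge0 (e : simplex) : 0 <= diam e.
Proof.
rewrite /diam; set S := [set _ | _ in _ & _ in _].
(* A set without supremum gets the default [sup] 0, which is nonnegative as well. *)
have [hS|/sup_out ->//] := pselect (has_sup S).
have [[z Sz] _] := hS.
apply: (@le_trans _ _ z); last exact: sup_upper_bound.
by case: Sz => x _ [y _ <-]; exact: sqrtr_ge0.
Qed.

Lemma mean_ge0 (f : pw_field T R) (e : simplex) x :
  (forall K, K \in elts_at e -> 0 <= f K x) -> 0 <= mean f e x.
Proof.
by move=> h; rewrite /mean; apply: mulr_ge0; rewrite ?invr_ge0//; exact: sumr_ge0.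
Qed.

Lemma form_dN_diag_le0 (kappa eta : R) (w f : pw_field T R) : (0 < d)%N ->
  0 <= kappa -> 0 < eta -> values_in w [set t | 0 <= t] ->
  values_in f [set t | 0 < t] -> form_dN kappa eta w f f <= 0.
Proof.
move=> d0 kappa0 eta0 w0 f0; rewrite /form_dN.
set B := \sum_(e in faces_int T) int_face e _; rewrite addrK.
rewrite -opprD oppr_le0 addr_ge0//.
  apply: sumr_ge0 => K KT; apply: Rintegral_ge0 => x Kx.
  apply: mulr_ge0; last exact: dotv_ge0.
  apply: mulr_ge0 => //; apply: divr_ge0; first exact: w0.
  by apply: ltW; exact: f0.
apply: sumr_ge0 => e; rewrite inE => /andP[/eqP ce _].
apply: mulr_ge0; first by rewrite divr_ge0 ?diam_ge0// ltW.
apply: mulr_ge0; first exact: sqrtr_ge0.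
apply: Rintegral_ge0 => t ht; set x := face_vtx e 0 + _.
have Kx K : K \in elts_at e -> K \in elts T /\ cell K x.
  by rewrite inE => /andP[KT eK]; split => //; exact: face_point_in_cell.
apply: mulr_ge0; last exact: dotv_ge0.
apply: divr_ge0; apply: mean_ge0 => K /Kx[KT Kx'].
  exact: w0.
by apply: ltW; exact: f0.
Qed.

Lemma int_bd_face_eq0 (e : simplex) (F : simplex -> rv -> rv -> R) :
  (forall K n x, K \in elts_at e -> F K n x = 0) -> int_bd_face e F = 0.
Proof.
move=> h; apply: big1 => K Ke; apply: int_face_eq0 => x; exact: h.
Qed.

(** The entropy equation subtracts both forms, so they are bounded together. The boundary data [T0]
    and [q0] have no sign, but each boundary integrand carries the factor [w K], which vanishes on
    the elements at the boundary. *)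
Lemma form_d_form_e_diag_le0 (kappa eta : R) (bc : boundary_condition R d)
    (w f : pw_field T R) : (0 < d)%N ->
  0 <= kappa -> 0 < eta -> values_in w [set t | 0 <= t] ->
  values_in f [set t | 0 < t] ->
  (if bc is NeumannHomogeneous then True else
    forall e K, e \in faces_bd T -> K \in elts_at e -> w K = fun=> 0) ->
  form_d kappa eta bc w f f + form_e kappa eta bc w f <= 0.
Proof.
move=> d0 kappa0 eta0 w0 f0.
have dN := form_dN_diag_le0 d0 kappa0 eta0 w0 f0.
case: bc => [_|T0 hw|q0 hw] /=; first by rewrite addr0.
- rewrite !big1 ?oppr0 ?addr0// => e he.
  + by rewrite int_bd_face_eq0 ?mulr0// => K n x Ke; rewrite (hw e)// mul0r.
  + by rewrite int_bd_face_eq0// => K n x Ke; rewrite (hw e)// !mul0r.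
  + by rewrite int_bd_face_eq0// => K n x Ke; rewrite (hw e)// !mul0r.
  + by rewrite int_bd_face_eq0// => K n x Ke; rewrite (hw e)// !mul0r.
- rewrite !big1 ?addr0// => e he.
  + by rewrite int_bd_face_eq0// => K n x Ke; rewrite (hw e)// mul0r.
  + by rewrite int_bd_face_eq0// => K n x Ke; rewrite (hw e)// !mul0r.
Qed.

Lemma assemble_midpoint (f g : pw_field T R) :
  assemble (fun K x => 2^-1 * (f K x + g K x)) =
  fun x => 2^-1 * (assemble f x + assemble g x).
Proof.
apply/funext => x; rewrite /assemble -big_split mulr_sumr.
by apply: eq_bigr => K _ /=; ring.
Qed.

Lemma Ugrad_midpoint (Om : set rv) r (u v : pw_field T rv) : open Om ->
  Ugrad Om r u -> Ugrad Om r v -> Ugrad Om r (midpoint u v).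
Proof.
move=> oOm [pu hu] [pv hv].
have mE i : (fun K x => midpoint u v K x 0 i) =
    fun K x => 2^-1 * (u K x 0 i + v K x 0 i).
  by apply/funext => K; apply/funext => x; rewrite /midpoint !mxE.
split => [K KT i|i].
  have -> : (fun x => midpoint u v K x 0 i) =
      fun x => 2^-1 * u K x 0 i + 2^-1 * v K x 0 i.
    by apply/funext => x; rewrite /midpoint !mxE mulrDr.
  by apply: polynomial_le_lin; [exact: pu|exact: pv].
by rewrite mE assemble_midpoint; exact: H10_midpoint.
Qed.

Lemma continuous_dotv (u v : rv -> rv) :
  (forall i, continuous (fun x => u x 0 i)) ->
  (forall i, continuous (fun x => v x 0 i)) ->
  continuous (fun x => dotv (u x) (v x)).
Proof.
move=> cu cv; rewrite (_ : (fun _ => _) = fun x => \sum_i u x 0 i * v x 0 i).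
  apply: (@continuous_big R _ +%R 0 predT) => [|i _ x].
    exact: add_continuous.
  by apply: continuousM; [exact: cu|exact: cv].
by apply/funext => x; rewrite dotvE.
Qed.

End forms.

Section energy_increment.
Variable R : realType.
Implicit Types eps : R -> R -> R.

Lemma delta1_mulr eps r r' s : (r' - r) * delta1 eps r r' s = eps r' s - eps r s.
Proof.
rewrite /delta1; case: eqVneq => [->|rr']; first by rewrite !subrr mul0r.
by rewrite mulrCA divff ?mulr1// subr_eq0.
Qed.

Lemma delta2_mulr eps s s' r : (s' - s) * delta2 eps s s' r = eps r s' - eps r s.
Proof. exact: (delta1_mulr (fun s r => eps r s)). Qed.

(* The kinetic part uses [rho1 |u1|^2 - rho0 |u0|^2 =
   (rho1 u1 - rho0 u0) . (u0 + u1) - (rho1 - rho0) u0 . u1]. *)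
Lemma energy_density_increment d eps (tau r0 r1 s0 s1 phi : R)
    (u0 u1 : 'rV[R]_d) :
  tau^-1 * (2^-1 * r1 * dotv u1 u1 + eps r1 s1 + r1 * phi)
  + - tau^-1 * (2^-1 * r0 * dotv u0 u0 + eps r0 s0 + r0 * phi) =
  dotv (tau^-1 *: (r1 *: u1 - r0 *: u0)) (2^-1 *: (u0 + u1))
  + (tau^-1 * (r1 - r0)) * (- 2^-1 * dotv u0 u1
      + 2^-1 * (delta1 eps r0 r1 s0 + delta1 eps r0 r1 s1) + phi)
  + (tau^-1 * (s1 - s0)) * (2^-1 * (delta2 eps s0 s1 r0 + delta2 eps s0 s1 r1)).
Proof.
have -> : tau^-1 *: (r1 *: u1 - r0 *: u0)
    = (tau^-1 * r1) *: u1 + (- tau^-1 * r0) *: u0.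
  by rewrite scalerBr !scalerA mulNr scaleNr.
rewrite scalerDr dotv_linl !dotv_linr (dotvC u1 u0).
have E1 := delta1_mulr eps r0 r1 s0; have E2 := delta1_mulr eps r0 r1 s1.
have E3 := delta2_mulr eps s0 s1 r0; have E4 := delta2_mulr eps s0 s1 r1.
have -> : tau^-1 * (r1 - r0) * (- 2^-1 * dotv u0 u1
      + 2^-1 * (delta1 eps r0 r1 s0 + delta1 eps r0 r1 s1) + phi) =
    tau^-1 * (- 2^-1 * (r1 - r0) * dotv u0 u1 + 2^-1 *
      ((r1 - r0) * delta1 eps r0 r1 s0 + (r1 - r0) * delta1 eps r0 r1 s1)
      + (r1 - r0) * phi) by ring.
have -> : tau^-1 * (s1 - s0) *
      (2^-1 * (delta2 eps s0 s1 r0 + delta2 eps s0 s1 r1)) =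
    tau^-1 * (2^-1 *
      ((s1 - s0) * delta2 eps s0 s1 r0 + (s1 - s0) * delta2 eps s0 s1 r1)) by ring.
by rewrite E1 E2 E3 E4; move: (tau^-1) => k; field.
Qed.

End energy_increment.

Theorem proposition3p2 (R : realType) (d : nat) (hd : d = 2%N \/ d = 3%N)
    (Om : set 'rV[R]_d) (hOm : bounded_domain Om)
    (T : triangulation R d) (hT : exactly_triangulates T Om)
    (q r : nat) (hr : (1 <= r)%N)
    (mu lam kappa eta : R) (hmu : 0 <= mu) (hlam : 0 <= lam + 2 / d%:R * mu)
    (hkappa : 0 <= kappa) (heta : 0 < eta)
    (bc : boundary_condition R d)
    (phi : 'rV[R]_d -> R) (hphi_meas : measurable_fun Om phi)
    (hphi_bounded : exists M : R, forall x, Om x -> `|phi x| <= M)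
    (tau : R) (htau : 0 < tau)
    (u0 u1 : pw_field T 'rV[R]_d) (rho0 rho1 s0 s1 : pw_field T R)
    (hu0 : Ugrad Om r u0) (hu1 : Ugrad Om r u1)
    (hrho0 : DG q rho0) (hrho1 : DG q rho1) (hs0 : DG q s0) (hs1 : DG q s1)
    (eps : R -> R -> R) (I J : set R)
    (hI : open I /\ is_interval I) (hJ : open J /\ is_interval J)
    (heps : C1_on eps I J)
    (hrho0I : values_in rho0 I) (hrho1I : values_in rho1 I)
    (hs0J : values_in s0 J) (hs1J : values_in s1 J) :
  let D1 := D1eps eps Om q rho0 rho1 s0 s1 in
  let D2 := D2eps eps Om q rho0 rho1 s0 s1 in
  let uh := midpoint u0 u1 in
  let rhoh := midpoint rho0 rho1 in
  let sh := midpoint s0 s1 in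
  let m0 := scale_field rho0 u0 in
  let m1 := scale_field rho1 u1 in
  let kin := L2proj Om q (fun K x => dotv (u0 K x) (u1 K x)) in
  let pot := L2proj Om q (fun _ x => phi x) in
  let entropy_production := fun w : pw_field T R =>
    inner Om (time_diff tau s0 s1) (mul_field D2 w)
    + form_b (mul_field D2 w) sh uh
    - form_d kappa eta bc (@one_field R d T) D2 (mul_field D2 w) in
  values_in D2 [set t | 0 < t] ->
  (forall v, Ugrad Om r v ->
    innerv Om (time_diff tau m0 m1) v + form_a Om (midpoint m0 m1) uh v - form_b D2 sh v
    + form_b (fun K x => 2^-1 * kin K x - D1 K x - pot K x) rhoh v
    = - form_c Om mu lam (@one_field R d T) uh v) ->
  (forall theta, DG q theta ->
    inner Om (time_diff tau rho0 rho1) theta + form_b theta rhoh uh = 0) ->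
  (forall w, DG q w ->
    entropy_production w
    = form_c Om mu lam w uh uh - form_d kappa eta bc w D2 D2
      - form_e kappa eta bc w D2) ->
  [/\ (energy eps Om phi u1 rho1 s1 - energy eps Om phi u0 rho0 s0) / tau
      = - form_e kappa eta bc (@one_field R d T) D2,
      int_Om Om rho1 = int_Om Om rho0 &
      forall w, DG 0 w -> values_in w [set t | 0 <= t] ->
        (if bc is NeumannHomogeneous then True
         else compactly_supported Om (assemble w)) ->
        0 <= entropy_production w].
Proof.
move=> D1 D2 uh rhoh sh m0 m1 kin pot entropy_production D2pos hmom hdens hent.
have d0 : (0 < d)%N by case: hd => ->.
have oOm : open Om by case: hOm.
have hD := @pw_bounded_measurableM R d T.
pose Dr := time_diff tau rho0 rho1; pose Ds := time_diff tau s0 s1.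
have DG_td (f g : pw_field T R) : DG q f -> DG q g -> DG q (time_diff tau f g).
  move=> hf hg; rewrite (_ : time_diff tau f g =
    fun K x => tau^-1 * g K x + - tau^-1 * f K x); first exact: DG_lin.
  by apply/funext => K; apply/funext => x; rewrite /time_diff scalerBr mulNr.
have hDr : DG q Dr by exact: DG_td.
have hDs : DG q Ds by exact: DG_td.
have h1 : DG q (@one_field R d T) by move=> K _; exact: polynomial_le_cst.
have bDr := DG_bounded_measurable hDr; have bDs := DG_bounded_measurable hDs.
have cu0 K i : K \in elts T -> continuous (fun x => u0 K x 0 i).
  by move=> KT; apply: continuous_polynomial_le; case: hu0 => h _; exact: h.
have cu1 K i : K \in elts T -> continuous (fun x => u1 K x 0 i).
  by move=> KT; apply: continuous_polynomial_le; case: hu1 => h _; exact: h.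
have cr (f : pw_field T R) K : DG q f -> K \in elts T -> continuous (f K).
  by move=> hf KT; apply: continuous_polynomial_le; exact: hf.
have bdot (u v : pw_field T 'rV[R]_d) :
    (forall K i, K \in elts T -> continuous (fun x => u K x 0 i)) ->
    (forall K i, K \in elts T -> continuous (fun x => v K x 0 i)) ->
    pw_bounded_measurable (fun K x => dotv (u K x) (v K x)).
  move=> cu cv K KT; apply: continuous_bounded_measurable => //.
  by apply: continuous_dotv => i; [exact: cu|exact: cv].
have buu := bdot _ _ cu0 cu1.
have cuh K i : K \in elts T -> continuous (fun x => uh K x 0 i).
  move=> KT; rewrite (_ : (fun _ => _) = fun x => 2^-1 * (u0 K x 0 i + u1 K x 0 i)).
    move=> x; apply: (@continuousM _ _ (fun=> 2^-1)
      (fun x => u0 K x 0 i + u1 K x 0 i)); first exact: cst_continuous.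
    apply: (@continuousD _ _ _ (fun x => u0 K x 0 i) (fun x => u1 K x 0 i)).
      exact: cu0.
    exact: cu1.
  by apply/funext => x; rewrite /uh /midpoint !mxE.
have cm K i : K \in elts T -> continuous (fun x => time_diff tau m0 m1 K x 0 i).
  move=> KT; rewrite (_ : (fun _ => _) = fun x =>
      tau^-1 * (rho1 K x * u1 K x 0 i - rho0 K x * u0 K x 0 i)).
    move=> x; apply: (@continuousM _ _ (fun=> tau^-1)
      (fun x => rho1 K x * u1 K x 0 i - rho0 K x * u0 K x 0 i)).
      exact: cst_continuous.
    apply: (@continuousB _ _ _ (fun x => rho1 K x * u1 K x 0 i)
      (fun x => rho0 K x * u0 K x 0 i)).
      apply: (@continuousM _ _ (rho1 K) (fun x => u1 K x 0 i)); first exact: cr.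
      exact: cu1.
    apply: (@continuousM _ _ (rho0 K) (fun x => u0 K x 0 i)); first exact: cr.
    exact: cu0.
  by apply/funext => x; rewrite /time_diff /m0 /m1 /scale_field !mxE.
have bmu := bdot _ _ cm cuh.
have bphi : pw_bounded_measurable (fun (_ : {set 'I_(nvert T)}) x => phi x).
  move=> K KT; have KO := cell_interior_sub_Om hT KT; split.
    by apply: measurable_funS hphi_meas; [exact: measurable_Om hOm|exact: KO].
  by case: hphi_bounded => M hM; exists M => x /KO /hM.
(* One compact box per element, inside [I] x [J], contains the values of both states; all bounds on
   [eps] and its divided differences are taken there. *)
have rng K : K \in elts T -> exists a b a' b', [/\ a <= b, a' <= b',
    `[a, b] `<=` I, `[a', b'] `<=` J &
    [/\ forall x, (cell K)° x -> a <= rho0 K x <= b,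
        forall x, (cell K)° x -> a <= rho1 K x <= b,
        forall x, (cell K)° x -> a' <= s0 K x <= b' &
        forall x, (cell K)° x -> a' <= s1 K x <= b']].
  move=> KT.
  have [a [b [ab abI r0 r1]]] := values_in_segment KT (proj2 hI)
    (cr _ _ hrho0 KT) (cr _ _ hrho1 KT) (hrho0I K KT) (hrho1I K KT).
  have [a' [b' [ab' abJ r0' r1']]] := values_in_segment KT (proj2 hJ)
    (cr _ _ hs0 KT) (cr _ _ hs1 KT) (hs0J K KT) (hs1J K KT).
  exists a, b, a', b'; split => //.
  by split => x /interior_subset; [exact: r0|exact: r1|exact: r0'|exact: r1'].
pose d1 : pw_field T R := fun K x => 2^-1 *
  (delta1 eps (rho0 K x) (rho1 K x) (s0 K x)
   + delta1 eps (rho0 K x) (rho1 K x) (s1 K x)).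
pose d2 : pw_field T R := fun K x => 2^-1 *
  (delta2 eps (s0 K x) (s1 K x) (rho0 K x)
   + delta2 eps (s0 K x) (s1 K x) (rho1 K x)).
have oK K : open ((cell K)° : set 'rV[R]_d) by exact: open_interior.
have bd1 : pw_bounded_measurable d1.
  move=> K KT; have [a [b [a' [b' [ab ab' abI abJ [r0 r1 z0 z1]]]]]] := rng K KT.
  apply: bounded_measurableM; first exact: bounded_measurable_cst.
  by apply: bounded_measurableD;
    apply: (bounded_measurable_delta1 heps ab ab' abI abJ) => //; exact: cr.
have bd2 : pw_bounded_measurable d2.
  move=> K KT; have [a [b [a' [b' [ab ab' abI abJ [r0 r1 z0 z1]]]]]] := rng K KT.
  apply: bounded_measurableM; first exact: bounded_measurable_cst.
  by apply: bounded_measurableD;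
    apply: (bounded_measurable_delta1 (C1_on_swap heps) ab' ab abJ abI) => //;
    exact: cr.
have beps0 : pw_bounded_measurable (fun K x => eps (rho0 K x) (s0 K x)).
  move=> K KT; have [a [b [a' [b' [ab ab' abI abJ [r0 r1 z0 z1]]]]]] := rng K KT.
  by apply: (bounded_measurable_C1_comp heps ab ab' abI abJ) => //; exact: cr.
have beps1 : pw_bounded_measurable (fun K x => eps (rho1 K x) (s1 K x)).
  move=> K KT; have [a [b [a' [b' [ab ab' abI abJ [r0 r1 z0 z1]]]]]] := rng K KT.
  by apply: (bounded_measurable_C1_comp heps ab ab' abI abJ) => //; exact: cr.
have [dD1 iD1] := L2projP hOm hT q bd1.
have [dD2 iD2] := L2projP hOm hT q bd2.
have [dkin ikin] := L2projP hOm hT q buu.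
have [dpot ipot] := L2projP hOm hT q bphi.
rewrite -/(D1eps eps Om q rho0 rho1 s0 s1) -/D1 in dD1 iD1.
rewrite -/(D2eps eps Om q rho0 rho1 s0 s1) -/D2 in dD2 iD2.
rewrite -/kin in dkin ikin; rewrite -/pot in dpot ipot.
have bD1 := DG_bounded_measurable dD1; have bD2 := DG_bounded_measurable dD2.
have bkin := DG_bounded_measurable dkin; have bpot := DG_bounded_measurable dpot.
have lin := int_Om_lin hOm hT.
(* Minus the projected coefficient of [Dr] in the energy increment, whence the term
   [- inner Om Dr theta] below; it is also the first argument of [form_b] in the momentum
   equation. *)
pose theta : pw_field T R := fun K x => 2^-1 * kin K x - D1 K x - pot K x.
have dtheta : DG q theta.
  rewrite (_ : theta = fun K x =>
    1 * (2^-1 * kin K x + -1 * D1 K x) + -1 * pot K x).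
    by apply: DG_lin => //; exact: DG_lin.
  by apply/funext => K; apply/funext => x; rewrite /theta; ring.
have D21 : mul_field D2 (@one_field R d T) = D2.
  by apply/funext => K; apply/funext => x; rewrite /mul_field mulr1.
split.
- have Hm := hmom uh (Ugrad_midpoint oOm hu0 hu1).
  have Hd := hdens theta dtheta.
  have := hent (@one_field R d T) h1; rewrite /entropy_production D21 => He.
  rewrite form_a_diag -/theta in Hm; rewrite -/Dr in Hd; rewrite -/Ds in He.
  have Ebm (rho s : pw_field T R) (u : pw_field T 'rV[R]_d) : DG q rho ->
      (forall K i, K \in elts T -> continuous (fun x => u K x 0 i)) ->
      pw_bounded_measurable (fun K x => eps (rho K x) (s K x)) ->
      pw_bounded_measurable (fun K x =>
        2^-1 * rho K x * dotv (u K x) (u K x) + eps (rho K x) (s K x)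
        + rho K x * phi x).
    move=> dr cu be K KT; have br := DG_bounded_measurable dr.
    apply: bounded_measurableD; last first.
      by apply: bounded_measurableM; [exact: br|exact: bphi].
    apply: bounded_measurableD; last exact: be.
    apply: bounded_measurableM; last exact: bdot.
    apply: bounded_measurableM; [exact: bounded_measurable_cst|exact: br].
  have -> : (energy eps Om phi u1 rho1 s1 - energy eps Om phi u0 rho0 s0) / tau
      = innerv Om (time_diff tau m0 m1) uh - inner Om Dr theta + inner Om Ds D2.
    transitivity (innerv Om (time_diff tau m0 m1) uh
        + (- 2^-1 * inner Om Dr (fun K x => dotv (u0 K x) (u1 K x))
           + inner Om Dr d1 + inner Om Dr (fun _ x => phi x)) + inner Om Ds d2).
      have -> : (energy eps Om phi u1 rho1 s1 - energy eps Om phi u0 rho0 s0) / tau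
        = tau^-1 * energy eps Om phi u1 rho1 s1
          + - tau^-1 * energy eps Om phi u0 rho0 s0 by ring.
      rewrite /energy -lin; [|exact: Ebm|exact: Ebm].
      pose g1 : pw_field T R := fun K x => dotv (time_diff tau m0 m1 K x) (uh K x).
      pose g2 : pw_field T R := fun K x => Dr K x * dotv (u0 K x) (u1 K x).
      pose g3 : pw_field T R := fun K x => Dr K x * d1 K x.
      pose g4 : pw_field T R := fun K x => Dr K x * phi x.
      pose g5 : pw_field T R := fun K x => Ds K x * d2 K x.
      have L (a b : R) (f g : pw_field T R) :=
        @pw_bounded_measurable_lin R d T a b f g.
      have b1 : pw_bounded_measurable g1 by exact: bmu.
      have b2 : pw_bounded_measurable g2 by exact: hD.
      have b3 : pw_bounded_measurable g3 by exact: hD.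
      have b4 : pw_bounded_measurable g4 by exact: hD.
      have b5 : pw_bounded_measurable g5 by exact: hD.
      have b32 := L (- 2^-1) 1 _ _ b2 b3.
      have b432 := L 1 1 _ _ b32 b4.
      have b1234 := L 1 1 _ _ b1 b432.
      (* The coefficients 1 give every sum the shape of a linear combination, so that [lin] alone
         splits the integral. *)
      transitivity (int_Om Om (fun K x => 1 * (1 * g1 K x + 1 * (1 *
          (- 2^-1 * g2 K x + 1 * g3 K x) + 1 * g4 K x)) + 1 * g5 K x)).
        congr int_Om; apply/funext => K; apply/funext => x.
        rewrite energy_density_increment !mul1r /g1 /g2 /g3 /g4 /g5.
        rewrite (_ : Dr K x = tau^-1 * (rho1 K x - rho0 K x))//.
        rewrite !(mulrDr (tau^-1 * (rho1 K x - rho0 K x))).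
        by congr (_ + _); congr (_ + _); rewrite /d1; ring.
      rewrite (lin _ _ _ _ b1234 b5) (lin _ _ _ _ b1 b432).
      by rewrite (lin _ _ _ _ b32 b4) (lin _ _ _ _ b2 b3) !mul1r.
    rewrite ikin// iD1// ipot// iD2//; congr (_ + _ + _).
    have btk := hD _ _ bDr bkin; have bt1 := hD _ _ bDr bD1.
    have btp := hD _ _ bDr bpot.
    have bl := @pw_bounded_measurable_lin R d T 2^-1 (-1) _ _ btk bt1.
    have -> : inner Om Dr theta = 1 * (2^-1 * inner Om Dr kin
        + -1 * inner Om Dr D1) + -1 * inner Om Dr pot.
      rewrite -(lin _ _ _ _ btk bt1) -(lin _ _ _ _ bl btp).
      congr int_Om; apply/funext => K; apply/funext => x; rewrite /theta.
      move: (Dr K x) (kin K x) (D1 K x) (pot K x) => *; ring.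
    move: (inner Om Dr kin) (inner Om Dr D1) (inner Om Dr pot) => *; ring.
  (* Only linear algebra remains. With [w = 1] the same [form_d] term stands on both sides of the
     entropy equation, each of the two [form_b] terms occurs in two equations, and dissipation lost
     by momentum reappears in the entropy equation; [form_e] alone survives. *)
  move: Hm Hd He; move: (form_c _ _ _ _ _ _) (form_d _ _ _ _ _ _) => c dd.
  move: (form_e _ _ _ _ _) (form_b _ _ _) (form_b _ _ _) => e b1 b2.
  move: (inner _ _ _) (inner _ _ _) (innerv _ _ _) => i1 i2 i3 ? ? ?; lra.
- have := hdens _ h1; rewrite form_b_one_field// addr0.
  have -> : inner Om (time_diff tau rho0 rho1) (@one_field R d T) =
      tau^-1 * int_Om Om rho1 + - tau^-1 * int_Om Om rho0.
    rewrite -(lin _ _ _ _ (DG_bounded_measurable hrho1)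
      (DG_bounded_measurable hrho0)).
    congr int_Om; apply/funext => K; apply/funext => x.
    by rewrite /time_diff /one_field mulr1 scalerBr mulNr.
  rewrite mulNr -mulrBr => /eqP; rewrite mulf_eq0 invr_eq0 gt_eqF//=.
  by rewrite subr_eq0 => /eqP.
- move=> w w0 wge hsupp.
  have hw : DG q w.
    move=> K KT; have [a ->] := polynomial_le0 (w0 K KT).
    exact: polynomial_le_cst.
  rewrite hent//.
  have c0 := form_c_ge0 Om uh d0 hmu hlam wge.
  have : form_d kappa eta bc w D2 D2 + form_e kappa eta bc w D2 <= 0.
    apply: form_d_form_e_diag_le0 => //.
    by case: bc hsupp {hent entropy_production} => // ? hs e K he Ke;
      exact: (compactly_supported_boundary_element d0 hT w0 wge hs he Ke).
  lra.
Qed.
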